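(* Let $a,m\in\mathbb{N}$, $b,r\in\mathbb{Z}$, $c\in\mathbb{R}_{>0}$, $d\in\mathbb{R}$ be constants. Put \[D:=\frac{a}{c}\cdot\frac{\varphi((am,ar+b))}{(am,ar+b)}\] and \[M:=\left\{ n\in\mathbb{N}:\ n> \max\Big\{-\frac{b}{a},-\frac{d}{c}\Big\}\ \text{ and }\ \frac{\varphi(an+b)}{cn+d}\leq D\right\}.\] Then the set \[L:=\left\{\frac{\varphi(an+b)}{cn+d}:\ n\in M,\ n\equiv r\bmod m\right\}\] is dense in $]0,D]$. Furthermore, for arbitrary $t\in\mathbb{N}$, we can restrict $L$ (i.e. restrict the $n$ allowed in the definition of $L$) by any of the following conditions on $n$ such that $L$ remains dense in $]0,D]$: \begin{enumerate} \item[(1)] $\frac{an+b}{(am,ar+b)}$ is squarefree; \item[(2)] $\frac{an+b}{(am,ar+b)}$ and $t$ are coprime; \item[(3)] there is at most one prime factor $p\mid\frac{an+b}{(am,ar+b)}$ such that $p\not\equiv 1\bmod a$, and if it exists, it has multiplicity $1$ and $a>1$. \end{enumerate}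
   Context: $\mathbb{N}$ is the set of positive integers, $\varphi$ is Euler's totient function, and $(u,v)=\gcd(u,v)$. The half-open interval is $]0,D]=\{x\in\mathbb{R}: 0<x\le D\}$. *)

(* Defs.v *)
From HB Require Import structures.
From mathcomp Require Import all_boot all_order all_algebra.
From mathcomp Require Import all_classical all_reals all_analysis.

Set Implicit Arguments.
Unset Strict Implicit.
Unset Printing Implicit Defensive.

Import Order.TTheory GRing.Theory Num.Theory.
Import numFieldNormedType.Exports.

Local Open Scope classical_set_scope.
Local Open Scope ring_scope.

(* Unlike the library's [dense], relative to an ambient set [A]. *)
Definition dense_in (T : topologicalType) (A S : set T) : Prop :=
  S `<=` A /\ A `<=` closure S.

Definition squarefree (k : nat) : Prop :=
  forall e : nat, (e ^ 2 %| k)%N -> e = 1%N.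

(* [absz] is only there to land in [nat]: a n + b > 0 for every n
   in [setM] below. *)
Definition affine (a : nat) (b : int) (n : nat) : nat :=
  absz (a%:Z * n%:Z + b).

Definition gcd_ab (a m : nat) (b r : int) : nat :=
  absz (gcdz (a%:Z * m%:Z) (a%:Z * r + b)).

(* The division is exact when n = r mod m. *)
Definition cofact (a m : nat) (b r : int) (n : nat) : nat :=
  (affine a b n %/ gcd_ab a m b r)%N.

Definition phi_ratio (R : realType) (a : nat) (b : int) (c d : R) (n : nat) : R :=
  (totient (affine a b n))%:R / (c * n%:R + d).

Definition bigD (R : realType) (a m : nat) (b r : int) (c : R) : R :=
  a%:R / c * ((totient (gcd_ab a m b r))%:R / (gcd_ab a m b r)%:R).

Definition setM (R : realType) (a m : nat) (b r : int) (c d : R) : set nat :=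
  [set n | [/\ (0 < n)%N,
               Num.max (- (b%:~R / a%:R)) (- (d / c)) < n%:R
             & phi_ratio a b c d n <= bigD a m b r c]].

(* The set L with the admissible n further restricted to [E]. *)
Definition setL (R : realType) (a m : nat) (b r : int) (c d : R)
    (E : set nat) : set R :=
  [set phi_ratio a b c d n | n in
    [set n | [/\ setM a m b r c d n, (n%:Z = r %[mod m%:Z])%Z & E n]]].

Definition cond1 (a m : nat) (b r : int) (n : nat) : Prop :=
  squarefree (cofact a m b r n).

Definition cond2 (a m : nat) (b r : int) (t n : nat) : Prop :=
  coprime (cofact a m b r n) t.

(* "At most one" counts distinct primes; the multiplicity is asked for
   separately. *)
Definition cond3 (a m : nat) (b r : int) (n : nat) : Prop :=
  let exceptional p :=
    [/\ prime p, (p %| cofact a m b r n)%N & (p <> 1 %[mod a])%N] in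
  (forall p q : nat, exceptional p -> exceptional q -> p = q) /\
  (forall p : nat, exceptional p ->
     logn p (cofact a m b r n) = 1%N /\ (1 < a)%N).

(* Each flag switches one condition on, so that the flags range over all
   combinations of the three conditions. *)
Definition selected (a m : nat) (b r : int) (t : nat) (s1 s2 s3 : bool) :
    set nat :=
  [set n | [/\ s1 -> cond1 a m b r n, s2 -> cond2 a m b r t n
             & s3 -> cond3 a m b r n]].

(* Main.v *)
Require Import Defs.
From mathcomp Require Import all_boot all_order all_algebra ring lra zify.
From mathcomp Require Import all_classical all_reals all_analysis.
Set Implicit Arguments.
Unset Strict Implicit.
Unset Printing Implicit Defensive.
Import Order.TTheory GRing.Theory Num.Theory.
Local Open Scope ring_scope.

(** Put g = gcd (am, ar + b).  If Q is a product of distinct large primes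
    q = 1 mod am, and p is a much larger prime with p = (ar + b) / g
    modulo am / g, then g Q p = ar + b mod am, so g Q p = a n + b for some
    n = r mod m, and (a n + b) / g = Q p satisfies the three conditions at
    once: it is squarefree, its prime factors exceed t, and p is the only
    one that can fail to be 1 modulo a.  As p grows with Q fixed, the ratio
    phi (a n + b) / (c n + d) tends to D times the product of the 1 - 1/q
    ([ratio_factor_close]).  Such products are dense in ]0, 1] because the
    sum of 1/q over the primes q = 1 mod am diverges: multiplying the
    factors one after the other gives a sequence tending to 0 in small steps
    ([prime_product_dense]).  Hence [approximation], and the theorem.

    What remains is Dirichlet's theorem on primes in a residue class
    ([dirichlet]) with divergence of the sum of inverses
    ([sum_inv_primes_nbdd]).  The proof is that of Mertens and Shapiro, with
    real functions on the unit group G of Z/k in place of complex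
    characters.  For f on G with zero sum (a balanced function), let
    T_f (N) be the sum of f(n) Lambda(n) / n over n <= N, let L(f) be the
    sum of the series f(n) / n, and let M f be the function
    d |-> L(n |-> f(d n)).  On a character, M is multiplication by L(1, chi).
    - Lambda * 1 = ln gives T_{M f} = O(1) ([mangoldt_sum_ltransform]); so if
      M is onto, T_f = O(1) for all balanced f, which equidistributes the
      weights Lambda(n) / n over G.
    - If M f = 0, Moebius inversion gives T_f = - f(1) ln N + O(1)
      ([mangoldt_sum_lkernel]).
    - So let f be a nonzero element of the kernel of M and call a class p
      rich if the Mangoldt weight of p is unbounded.  The function
      q(n) = sum_i (f(i) + f(i n))^2 is nonnegative with T_q = O(1), as its
      two logarithms cancel; hence q vanishes at rich p, that is
      f(p n) = - f(n) ([lkernel_rich]).  A balanced function invariant under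
      the rich classes is 0: its transform by M vanishes because all the
      weight lies on rich classes, so it is in the kernel and is also
      negated by them ([rich_invariant_eq0]).  But f(n) f(g n), minus its
      mean, is such a function, for each g; so f(n) f(g n) is constant in n,
      and f / f(1) is a character with values 1 and -1 and L(1, chi) = 0.
    - This is impossible ([real_character_lvalue_neq0]).  The sums
      A(n) of chi over the divisors of n are nonnegative, and at least 1 at
      the squares, so the sum of A(n) t^n is unbounded as t tends to 1.
      But it is the sum of chi(n) t^n / (1 - t^n), and when L(1, chi) = 0
      one can subtract 1 / (n (1 - t)) from the coefficient of chi(n); what
      is left is monotone in n and at most 1, so its sum against chi is
      bounded.
    Thus M is injective on the finite-dimensional space of balanced
    functions ([lkernel_trivial]), hence onto. *)

(** * Sums over divisors *)

Section DivisorSums.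
Variable V : nmodType.
Implicit Types (F G : nat -> V) (d m n N p : nat).

Lemma sum_multiples G d N : (0 < d)%N ->
  \sum_(1 <= n < N.+1 | (d %| n)%N) G n = \sum_(1 <= e < (N %/ d).+1) G (d * e)%N.
Proof.
move=> d0; elim: N => [|N IH]; first by rewrite div0n !big_geq.
rewrite big_mkcond /= big_nat_recr //= -big_mkcond /= IH.
case: ifP => dN; last by rewrite addr0 divnS // dN.
have NE : (N.+1 %/ d = (N %/ d).+1)%N by rewrite divnS // dN.
by rewrite NE [RHS]big_nat_recr //= -NE mulnC divnK.
Qed.

Lemma sum_divisors_le F n N : (0 < n <= N)%N ->
  \sum_(d <- divisors n) F d = \sum_(1 <= d < N.+1 | (d %| n)%N) F d.
Proof.
move=> /andP[n0 nN]; rewrite -[RHS]big_filter; apply: perm_big.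
apply: uniq_perm; rewrite ?divisors_uniq ?filter_uniq ?iota_uniq // => d.
rewrite mem_filter mem_index_iota -dvdn_divisors //.
case dn: (d %| n)%N => //=; rewrite (dvdn_gt0 n0 dn) ltnS.
by rewrite (leq_trans (dvdn_leq n0 dn)).
Qed.

Lemma sum_divisors_exchange (g : nat -> nat -> V) N :
  \sum_(1 <= n < N.+1) \sum_(d <- divisors n) g d (n %/ d)%N =
  \sum_(1 <= d < N.+1) \sum_(1 <= e < (N %/ d).+1) g d e.
Proof.
transitivity (\sum_(1 <= n < N.+1) \sum_(1 <= d < N.+1 | (d %| n)%N) g d (n %/ d)%N).
  by apply: eq_big_nat => n; exact: sum_divisors_le.
under eq_bigr do rewrite big_mkcond.
rewrite exchange_big_nat; apply: eq_big_nat => d /andP[d0 _].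
rewrite -big_mkcond /= sum_multiples //.
by apply: eq_bigr => e _; rewrite mulKn.
Qed.

(** The divisors of p^a m are the p^j d with j <= a and d a divisor of m. *)
Lemma sum_divisors_pfactor F p a m : prime p -> (0 < m)%N -> ~~ (p %| m)%N ->
  \sum_(d <- divisors (p ^ a * m)) F d =
  \sum_(j < a.+1) \sum_(d <- divisors m) F (p ^ j * d)%N.
Proof.
move=> pp m0 pm; have p0 := prime_gt0 pp.
have pNd d : (d %| m)%N -> ~~ (p %| d)%N.
  by move=> dm; apply: contra pm => /dvdn_trans; exact.
rewrite -(big_mkord xpredT (fun j => \sum_(d <- divisors m) F (p ^ j * d)%N)).
rewrite -(big_allpairs_dep (h := fun j d => (p ^ j * d)%N) (r2 := fun=> divisors m)).
apply: perm_big; apply: uniq_perm; first exact: divisors_uniq.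
  apply: allpairs_uniq; rewrite ?iota_uniq ?divisors_uniq //.
  move=> u v /allpairsP[[i' x'] [_ xm ->]] /allpairsP[[j' y'] [_ ym ->]].
  move: xm ym => /=; rewrite -!dvdn_divisors // => xm ym E.
  have lE k z : (z %| m)%N -> logn p (p ^ k * z) = k.
    move=> zm; rewrite lognM ?expn_gt0 ?p0 ?(dvdn_gt0 m0 zm) // pfactorK //.
    by rewrite -[RHS]addn0; congr (_ + _)%N; apply/eqP; rewrite lognE pp (dvdn_gt0 m0 zm) /= (negbTE (pNd _ zm)).
  have ij : i' = j' by rewrite -(lE i' x') // E lE.
  by move: E; rewrite ij => /eqP; rewrite eqn_pmul2l ?expn_gt0 ?p0 // => /eqP ->.
move=> d; rewrite -dvdn_divisors ?muln_gt0 ?expn_gt0 ?p0 //.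
apply/idP/allpairsP => [dm|[[j x] /= []]]; last first.
  rewrite mem_index_iota -dvdn_divisors //= ltnS => ja xm ->.
  by rewrite dvdn_mul // dvdn_exp2l.
have d0 : (0 < d)%N by rewrite (dvdn_gt0 _ dm) // muln_gt0 expn_gt0 p0.
have [x px dE] := pfactor_coprime pp d0.
exists (logn p d, x) => /=; rewrite mem_index_iota -dvdn_divisors // ltnS; split.
- have := dvdn_leq_log p _ dm; rewrite muln_gt0 expn_gt0 p0 m0 => /(_ isT).
  rewrite lognM ?expn_gt0 ?p0 // pfactorK //.
  by rewrite [logn p m]lognE pp m0 /= (negbTE pm) addn0.
- rewrite -(@Gauss_dvdr _ (p ^ a)) ?coprimeXr 1?coprime_sym //.
  by apply: dvdn_trans dm; rewrite dE dvdn_mulr.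
- by rewrite {1}dE mulnC.
Qed.

End DivisorSums.

(** * The functions of von Mangoldt and Moebius *)

Section ArithmeticFunctions.
Variable R : realType.
Implicit Types (d m n N p : nat).

(** The prime powers are the integers with exactly one prime divisor. *)
Definition mangoldt n : R := if primes n is [:: p] then ln p%:R else 0.

Definition moebius n : R :=
  if all (fun p => logn p n == 1%N) (primes n) then (-1) ^+ size (primes n) else 0.

Lemma mangoldt_ge0 n : 0 <= mangoldt n.
Proof.
rewrite /mangoldt; case E: (primes n) => [|p [|//]] //.
have : p \in primes n by rewrite E mem_head.
by rewrite mem_primes => /andP[/prime_gt0 p0 _]; rewrite ln_ge0 // ler1n.
Qed.

Lemma mangoldt_prime p : prime p -> mangoldt p = ln p%:R.
Proof. by move=> pp; rewrite /mangoldt primes_prime. Qed.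

Lemma mangoldt_pfactor_eq0 p j d : prime p -> (0 < j)%N -> (1 < d)%N ->
  ~~ (p %| d)%N -> mangoldt (p ^ j * d) = 0.
Proof.
move=> pp j0 d1 pd; rewrite /mangoldt.
case E: (primes (p ^ j * d)) => [|q [|//]] //.
have mE q' : (q' \in primes (p ^ j * d)) = (q' == q) by rewrite E inE.
have d0 : (0 < d)%N by exact: ltn_trans d1.
have m0 : (0 < p ^ j * d)%N by rewrite muln_gt0 expn_gt0 prime_gt0.
have := mE p; rewrite mem_primes pp m0 dvdn_mulr ?dvdn_exp //= => /esym/eqP pq.
have := mE (pdiv d); rewrite mem_primes pdiv_prime // m0 dvdn_mull ?pdiv_dvd //=.
by move=> /esym/eqP dq; rewrite pq -dq pdiv_dvd in pd.
Qed.

Lemma mangoldt_pfactor p j : prime p -> (0 < j)%N -> mangoldt (p ^ j) = ln p%:R.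
Proof. by move=> pp j0; rewrite /mangoldt primesX // primes_prime. Qed.

Lemma pfactor_split n : (1 < n)%N ->
  exists p a m, [/\ prime p, (0 < m < n)%N, ~~ (p %| m)%N & (n = p ^ a.+1 * m)%N].
Proof.
move=> n1; have n0 := ltn_trans (ltn0Sn 0) n1.
have pp := pdiv_prime n1; have [m pm nE] := pfactor_coprime pp n0.
have l0 : (0 < logn (pdiv n) n)%N by rewrite logn_gt0 mem_primes pp n0 pdiv_dvd.
have m0 : (0 < m)%N by move: n0; rewrite nE; case: (m).
exists (pdiv n), (logn (pdiv n) n).-1, m; split => //.
- rewrite m0 [ltnRHS]nE -[ltnLHS]muln1 ltn_pmul2l // -(expn0 (pdiv n)).
  by rewrite ltn_exp2l // prime_gt1.
- by rewrite -prime_coprime.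
- by rewrite prednK // mulnC.
Qed.

Lemma divisors_in_notdvd p m d : (0 < m)%N -> ~~ (p %| m)%N -> d \in divisors m ->
  (0 < d)%N /\ ~~ (p %| d)%N.
Proof.
move=> m0 pm; rewrite -dvdn_divisors // => dm; split; first exact: dvdn_gt0 dm.
by apply: contra pm => /dvdn_trans; exact.
Qed.

(** Going from m to p^(a+1) m adds the divisors p, ..., p^(a+1), each of
    weight ln p, and divisors that are not prime powers. *)
Lemma sum_mangoldt n : (0 < n)%N -> \sum_(d <- divisors n) mangoldt d = ln n%:R.
Proof.
elim/ltn_ind: n => n IH n0; have [->|n1] := eqVneq n 1%N.
  by rewrite big_seq1 ln1.
have {}n1 : (1 < n)%N by lia.
have [p [a [m [pp /andP[m0 mn] pm nE]]]] := pfactor_split n1.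
rewrite {1}nE sum_divisors_pfactor // big_ord_recl.
under eq_bigr do rewrite mul1n.
rewrite IH // (eq_bigr (fun=> ln p%:R)) => [|j _]; last first.
  rewrite (bigD1_seq 1%N) ?divisor1 ?divisors_uniq //= muln1 mangoldt_pfactor //.
  rewrite big_seq_cond big1 ?addr0 // => d /andP[dm d1].
  have [d0 pd] := divisors_in_notdvd m0 pm dm.
  by rewrite mangoldt_pfactor_eq0 //; lia.
rewrite sumr_const card_ord nE natrM natrX lnM ?posrE ?exprn_gt0 ?ltr0n ?(prime_gt0 pp) //.
by rewrite lnXn ?ltr0n ?(prime_gt0 pp) // addrC.
Qed.

Lemma moebius_le1 n : `|moebius n| <= 1.
Proof. by rewrite /moebius; case: ifP => _; rewrite ?normr0 // normrX normrN1 expr1n. Qed.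

Lemma logn_notdvd p d : ~~ (p %| d)%N -> logn p d = 0%N.
Proof. by move=> pd; rewrite lognE (negbTE pd) !andbF. Qed.

Lemma moebius_prime_mul p d : prime p -> (0 < d)%N -> ~~ (p %| d)%N ->
  moebius (p * d) = - moebius d.
Proof.
move=> pp d0 pd; have p0 := prime_gt0 pp.
have P : perm_eq (primes (p * d)) (p :: primes d).
  apply: uniq_perm; rewrite ?primes_uniq //=.
    by rewrite mem_primes (negbTE pd) !andbF primes_uniq.
  by move=> q; rewrite primesM // primes_prime // inE.
rewrite /moebius (perm_all _ P) (perm_size P) /= lognM // logn_prime // eqxx.
rewrite logn_notdvd //= exprS mulN1r.
rewrite (@eq_in_all _ _ (fun q => logn q d == 1%N)); first by case: ifP => //; rewrite oppr0.
move=> q; rewrite mem_primes => /and3P[qq _ qd]; rewrite lognM // logn_prime //.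
by case: (eqVneq q p) => [E|_]; rewrite ?add0n //; rewrite -E qd in pd.
Qed.

Lemma moebius_pfactor_eq0 p j d : prime p -> (0 < d)%N -> ~~ (p %| d)%N ->
  (1 < j)%N -> moebius (p ^ j * d) = 0.
Proof.
move=> pp d0 pd j1; have p0 := prime_gt0 pp.
rewrite /moebius; case: allP => // /(_ p).
rewrite mem_primes pp muln_gt0 expn_gt0 p0 d0 dvdn_mulr ?dvdn_exp ?(ltnW j1) //=.
move=> /(_ isT); rewrite lognM ?expn_gt0 ?p0 // pfactorK // logn_notdvd //.
by rewrite addn0; case: eqP j1 => // ->.
Qed.

(** The divisors d and p d cancel, p being a prime divisor of n. *)
Lemma sum_moebius n : (0 < n)%N -> \sum_(d <- divisors n) moebius d = (n == 1%N)%:R.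
Proof.
move=> n0; have [->|n1] := eqVneq n 1%N; first by rewrite big_seq1.
have {}n1 : (1 < n)%N by lia.
have [p [a [m [pp /andP[m0 mn] pm ->]]]] := pfactor_split n1.
rewrite sum_divisors_pfactor // 2!big_ord_recl /= expn0 addrA.
rewrite [X in _ + X]big1 => [|j _]; last first.
  rewrite big_seq big1 // => d dm.
  have [d0 pd] := divisors_in_notdvd m0 pm dm.
  by rewrite moebius_pfactor_eq0.
rewrite addr0 -big_split big_seq big1 //= => d dm.
have [d0 pd] := divisors_in_notdvd m0 pm dm.
by rewrite mul1n expn1 moebius_prime_mul // subrr.
Qed.

End ArithmeticFunctions.

(** * Estimates of Chebyshev and Mertens *)

Section Chebyshev.
Variable R : realType.
Implicit Types (d m n N p : nat).
Local Notation Lambda := (mangoldt R).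
Local Notation "n %:r" := (n%:R : R) (at level 1, left associativity, format "n %:r").

Lemma ln_nat_ge0 n : 0 <= ln n%:r.
Proof. by case: n => [|n]; [rewrite ln0 | rewrite ln_ge0 // ler1n]. Qed.

Lemma ln_nat_mono m n : (0 < m)%N -> (m <= n)%N -> ln m%:r <= ln n%:r.
Proof.
by move=> m0 mn; rewrite ler_ln ?posrE ?ltr0n ?ler_nat //; exact: leq_trans mn.
Qed.

Lemma ln_succ_le n : (0 < n)%N -> ln n.+1%:r <= ln n%:r + n%:r^-1.
Proof.
move=> n0; have n0' : 0 < n%:r by rewrite ltr0n.
have -> : n.+1%:r = n%:r * (1 + n%:r^-1).
  by rewrite mulrDr mulr1 divff ?gt_eqF // -natr1.
rewrite lnM ?posrE // ?addr_gt0 ?invr_gt0 // lerD2l le_ln1Dx //.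
by rewrite (@lt_trans _ _ 0) ?invr_gt0 // oppr_lt0 ltr01.
Qed.

Lemma ln2_le1 : ln 2 <= 1 :> R.
Proof. by have := @ln_succ_le 1 isT; rewrite ln1 invr1 add0r. Qed.

Lemma sum_ln_le N : \sum_(1 <= n < N.+1) ln n%:r <= N%:r * ln N%:r.
Proof.
rewrite (@le_trans _ _ (\sum_(1 <= n < N.+1) ln N%:r)) //.
  rewrite big_nat [leRHS]big_nat; apply: ler_sum => n /andP[n0 nN].
  exact: ln_nat_mono.
by rewrite sumr_const_nat subn1 /= mulr_natl.
Qed.

Lemma sum_ln_ge N : N%:r * ln N%:r - N%:r <= \sum_(1 <= n < N.+1) ln n%:r.
Proof.
elim: N => [|N IH]; first by rewrite big_geq // mul0r subr0.
rewrite big_nat_recr //=; case: N IH => [|N] IH.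
  by rewrite big_geq // mulr1n ln1 mulr0 add0r addr0 oppr_le0 ler01.
have := ln_succ_le (ltn0Sn N); move: IH.
set x := N.+1%:r; have x0 : 0 < x by rewrite ltr0n.
have -> : N.+2%:r = x + 1 by rewrite -natr1.
move=> IH H; have : x * ln (x + 1) <= x * ln x + 1.
  by rewrite -[X in _ <= _ + X](divff (lt0r_neq0 x0)) -mulrDr ler_wpM2l // ltW.
by rewrite mulrDl mul1r; lra.
Qed.

Lemma sum_ln_mangoldt N :
  \sum_(1 <= n < N.+1) ln n%:r = \sum_(1 <= d < N.+1) Lambda d * (N %/ d)%:r.
Proof.
transitivity (\sum_(1 <= n < N.+1) \sum_(d <- divisors n) Lambda d).
  by apply: eq_big_nat => n /andP[n0 _]; rewrite sum_mangoldt.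
rewrite (sum_divisors_exchange (fun d _ => Lambda d)).
by apply: eq_bigr => d _; rewrite sumr_const_nat subn1 mulr_natr.
Qed.

(** This is the bound 4^N for the central binomial coefficient. *)
Lemma central_binomial_ln N :
  \sum_(1 <= n < N.*2.+1) ln n%:r <= 2 * \sum_(1 <= n < N.+1) ln n%:r + N%:r * 2.
Proof.
elim: N => [|N IH]; first by rewrite !big_geq // mul0r mulr0 addr0.
rewrite doubleS big_nat_recr //= big_nat_recr //= [in leRHS]big_nat_recr //=.
have E : ln N.*2.+2%:r = ln 2 + ln N.+1%:r.
  by rewrite -doubleS -muln2 natrM mulrC lnM ?posrE ?ltr0n.
have L : ln N.*2.+1%:r <= ln 2 + ln N.+1%:r by rewrite -E ln_nat_mono.
have N1 : N.+1%:r = N%:r + 1 by rewrite natr1.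
by have := ln2_le1; rewrite E; lra.
Qed.

(** By [sum_ln_mangoldt], the logarithm of the central binomial coefficient
    is the sum of Lambda d times the nonnegative integer
    (2 N %/ d) - 2 (N %/ d), which is 1 for N < d <= 2 N. *)
Lemma chebyshev_step N : \sum_(N.+1 <= d < N.*2.+1) Lambda d <= N%:r * 2.
Proof.
have := central_binomial_ln N; rewrite !sum_ln_mangoldt => H.
rewrite -(lerD2l (2 * \sum_(1 <= d < N.+1) Lambda d * (N %/ d)%:r)).
apply: le_trans H; rewrite [leRHS](big_cat_nat (n := N.+1)) //=; last by lia.
apply: lerD.
  rewrite mulr_sumr; apply: ler_sum => d _.
  rewrite mulrCA ler_wpM2l ?mangoldt_ge0 // -natrM ler_nat.
  case: d => [|d]; first by rewrite !divn0.
  by rewrite leq_divRL // -mulnA -mul2n leq_mul2l leq_trunc_div.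
rewrite big_nat [leRHS]big_nat; apply: ler_sum => d /andP[d1 d2].
by rewrite ler_peMr ?mangoldt_ge0 // ler1n divn_gt0; lia.
Qed.

(** Dyadic induction on [chebyshev_step]. *)
Lemma chebyshev_le N : \sum_(1 <= d < N.+1) Lambda d <= 4 * N%:r.
Proof.
elim/ltn_ind: N => N IH; have [->|N0] := posnP N; first by rewrite big_geq // mulr0.
have := IH N./2; rewrite ltn_half_double => /(_ ltac:(lia)) {}IH.
have := chebyshev_step N./2.
have : \sum_(1 <= d < N.+1) Lambda d <=
       \sum_(1 <= d < N./2.*2.+1) Lambda d + (odd N)%:R * ln N%:r.
  have := odd_double_half N; case: odd => /= E; last by rewrite -{1}E mul0r addr0.
  have E' : N = (N./2.*2).+1 by lia.
  rewrite [in leLHS]E' big_nat_recr //= -E' lerD2l mul1r.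
  rewrite /mangoldt; case P: primes => [|p [|//]]; rewrite ?ln_nat_ge0 //.
  have : p \in primes N by rewrite P mem_head.
  rewrite mem_primes => /and3P[pp _ pN].
  by rewrite ln_nat_mono ?prime_gt0 // dvdn_leq.
rewrite [in X in _ <= X -> _](big_cat_nat (n := N./2.+1)) //=; last by lia.
have : (odd N)%:R * ln N%:r <= (odd N)%:R * N%:r.
  by rewrite ler_wpM2l ?ler0n // ltW // ln_sublinear // ltr0n.
have : N%:r = (odd N)%:R + 2 * N./2%:r.
  by rewrite -{1}(odd_double_half N) natrD -muln2 natrM [2 * _]mulrC.
have : 0 <= N./2%:r by rewrite ler0n.
by case: (odd N); rewrite ?mulr1n ?mulr0n ?mul1r ?mul0r; lra.
Qed.

(** Both Mertens bounds compare N / d with its integer part in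
    [sum_ln_mangoldt]; for the upper one, the total rounding error is bounded
    by [chebyshev_le]. *)
Lemma mertens_le N : (0 < N)%N ->
  \sum_(1 <= d < N.+1) Lambda d / d%:r <= ln N%:r + 4.
Proof.
move=> N0; have N0' : 0 < N%:r by rewrite ltr0n.
rewrite -(ler_pM2l N0') mulrDr.
rewrite (@le_trans _ _ (\sum_(1 <= d < N.+1) Lambda d * (N %/ d)%:r +
                        \sum_(1 <= d < N.+1) Lambda d)) //.
  rewrite mulr_sumr -big_split /= big_nat [leRHS]big_nat.
  apply: ler_sum => d /andP[d0 _]; rewrite mulrCA -[X in _ + X]mulr1 -mulrDr.
  rewrite ler_wpM2l ?mangoldt_ge0 // ler_pdivrMr ?ltr0n // natr1 -natrM ler_nat.
  by rewrite ltnW // -ltn_divLR.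
by rewrite -sum_ln_mangoldt lerD ?sum_ln_le // mulrC chebyshev_le.
Qed.

Lemma mertens_ge N : (0 < N)%N ->
  ln N%:r - 1 <= \sum_(1 <= d < N.+1) Lambda d / d%:r.
Proof.
move=> N0; have N0' : 0 < N%:r by rewrite ltr0n.
rewrite -(ler_pM2l N0') mulrBr mulr1.
apply: (le_trans (sum_ln_ge N)); rewrite sum_ln_mangoldt mulr_sumr.
rewrite big_nat [leRHS]big_nat; apply: ler_sum => d /andP[d0 _].
rewrite mulrCA ler_wpM2l ?mangoldt_ge0 // ler_pdivlMr ?ltr0n // -natrM ler_nat.
exact: leq_trunc_div.
Qed.

End Chebyshev.

(** * Summation by parts *)

Section Abel.
Variable R : realType.

Lemma abel_bound (f w : nat -> R) (B : R) m N :
  (forall n, `|\sum_(0 <= i < n) f i| <= B) ->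
  (forall n, (m <= n)%N -> w n.+1 <= w n) -> (forall n, (m <= n)%N -> 0 <= w n) ->
  `|\sum_(m <= n < N) f n * w n| <= 2 * B * w m.
Proof.
move=> fB wdec w0; have B0 : 0 <= B by exact: le_trans (normr_ge0 _) (fB 0%N).
have [Nm|mN] := leqP N m; first by rewrite big_geq // normr0 !mulr_ge0 ?w0.
pose G n := \sum_(0 <= i < n) f i - \sum_(0 <= i < m) f i.
have GB n : `|G n| <= 2 * B.
  by apply: le_trans (ler_normB _ _) _; rewrite mulr2n mulrDl mul1r lerD.
suff : `|\sum_(m <= n < N) f n * w n - G N * w N| <= 2 * B * (w m - w N).
  move=> H; rewrite -[X in `|X|](subrK (G N * w N)).
  apply: le_trans (ler_normD _ _) _; rewrite -[w m](subrK (w N)) mulrDr.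
  by rewrite lerD // normrM (ger0_norm (w0 _ (ltnW mN))) ler_wpM2r // w0 // ltnW.
elim: N {mN} (ltnW mN) => [|N IH] mN.
  have -> : m = 0%N by lia.
  by rewrite /G !big_geq // !subrr mul0r subrr normr0 mulr0.
have [E|mN1] := eqVneq m N.+1.
  by rewrite -E big_geq // /G !subrr mul0r subrr normr0 mulr0.
have mN' : (m <= N)%N by lia.
rewrite big_nat_recr //=.
have GE : G N.+1 = G N + f N by rewrite /G big_nat_recr //=; ring.
have -> : \sum_(m <= n < N) f n * w n + f N * w N - G N.+1 * w N.+1 =
  (\sum_(m <= n < N) f n * w n - G N * w N) + G N.+1 * (w N - w N.+1).
  by rewrite GE; ring.
apply: le_trans (ler_normD _ _) _.
have -> : 2 * B * (w m - w N.+1) = 2 * B * (w m - w N) + 2 * B * (w N - w N.+1) by ring.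
apply: lerD; first exact: IH.
by rewrite normrM [X in _ * X]ger0_norm ?subr_ge0 ?wdec // ler_wpM2r // subr_ge0 wdec.
Qed.

End Abel.

(** * Prime powers are negligible *)

Section PrimePowers.
Variable R : realType.
Implicit Types (d m n N p : nat).
Local Notation Lambda := (mangoldt R).
Local Notation "n %:r" := (n%:R : R) (at level 1, left associativity, format "n %:r").

Lemma geometric_tail_le (x : R) N : 0 <= x <= 2^-1 ->
  \sum_(2 <= j < N) x ^+ j <= 2 * x ^+ 2.
Proof.
move=> /andP[x0 x1]; have [N2|N2] := leqP N 2.
  by rewrite big_geq // mulr_ge0 // exprn_ge0.
suff : \sum_(2 <= j < N) x ^+ j <= 2 * x ^+ 2 - 2 * x ^+ N.
  by have := exprn_ge0 N x0; lra.
elim: N N2 => // N IH; rewrite ltnS leq_eqVlt => /predU1P[<-|N2].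
  by rewrite big_nat1 exprS; have := exprn_ge0 2 x0; nra.
rewrite big_nat_recr ?(ltnW N2) //=; have := IH N2.
by rewrite [x ^+ N.+1]exprS; have := exprn_ge0 N x0; nra.
Qed.

(** Since ln n <= 2 sqrt n, the terms are dominated by the telescoping
    differences of 4 / sqrt n. *)
Lemma sum_ln_sqr_le N : \sum_(2 <= p < N) ln p%:r * p%:r^-1 ^+ 2 <= 4.
Proof.
have [N2|N2] := leqP N 2; first by rewrite big_geq.
suff : \sum_(2 <= p < N) ln p%:r * p%:r^-1 ^+ 2 <= 4 - 4 / Num.sqrt N.-1%:r.
  have : 0 <= (Num.sqrt N.-1%:r)^-1 by rewrite invr_ge0 sqrtr_ge0.
  lra.
have step n : (0 < n)%N -> ln n.+1%:r * n.+1%:r^-1 ^+ 2 <=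
    4 / Num.sqrt n%:r - 4 / Num.sqrt n.+1%:r.
  move=> n0; have u0 : 0 < Num.sqrt n%:r by rewrite sqrtr_gt0 ltr0n.
  have v0 : 0 < Num.sqrt n.+1%:r by rewrite sqrtr_gt0 ltr0n.
  have uv : Num.sqrt n.+1%:r ^+ 2 = Num.sqrt n%:r ^+ 2 + 1.
    by rewrite !sqr_sqrtr ?ler0n // natr1.
  rewrite -[n.+1%:r]sqr_sqrtr ?ler0n //= sqrtr_sqr ger0_norm ?(ltW v0) //.
  move: u0 v0 uv; set u := Num.sqrt n%:r; set v := Num.sqrt n.+1%:r => u0 v0 uv.
  have : ln (v ^+ 2) <= v * 2.
    by rewrite lnXn // mulr_natr lerMn2r /= ltW // ln_sublinear.
  move=> L; apply: (@le_trans _ _ (v * 2 * (v ^+ 2)^-1 ^+ 2)).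
    by rewrite ler_wpM2r // exprn_ge0 // invr_ge0 exprn_ge0 // ltW.
  have -> : v * 2 * (v ^+ 2)^-1 ^+ 2 = 2 / v ^+ 3 by field; rewrite gt_eqF.
  have -> : 4 / u - 4 / v = 4 * (v - u) / (u * v) by field; rewrite !gt_eqF.
  have uv' : u < v by nra.
  have W : v <= 2 * (v - u) * v ^+ 2.
    rewrite -(ler_pM2l (addr_gt0 u0 v0)).
    have -> : (u + v) * (2 * (v - u) * v ^+ 2) = 2 * (v ^+ 2 - u ^+ 2) * v ^+ 2 by ring.
    have -> : v ^+ 2 - u ^+ 2 = 1 by rewrite uv; ring.
    by nra.
  rewrite ler_pdivrMr ?exprn_gt0 //.
  have -> : 4 * (v - u) / (u * v) * v ^+ 3 = 4 * (v - u) * v ^+ 2 / u.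
    by field; rewrite !gt_eqF.
  by rewrite ler_pdivlMr //; lra.
elim: N N2 => // N IH; rewrite ltnS leq_eqVlt => /predU1P[<-|N2].
  by rewrite big_nat1; have := step 1%N isT; rewrite sqrtr1 divr1.
rewrite big_nat_recr ?(ltnW N2) //=; have := IH N2.
have := step N.-1 ltac:(lia); have -> : N.-1.+1 = N by lia.
by lra.
Qed.

(** The sum is over the p^j with j >= 2; for each p it is at most
    2 ln p / p^2. *)
Lemma sum_mangoldt_nonprime_le N :
  \sum_(1 <= n < N.+1 | ~~ prime n) Lambda n / n%:r <= 8.
Proof.
rewrite (@le_trans _ _ (\sum_(1 <= n < N.+1) \sum_(2 <= p < N.+1) \sum_(2 <= j < N.+1) (n == (p ^ j)%N)%:R * (ln p%:r * p%:r^-1 ^+ j))) //.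
  rewrite big_mkcond /= big_nat [leRHS]big_nat; apply: ler_sum => n /andP[n0 nN].
  have nn p j : 0 <= (n == (p ^ j)%N)%:R * (ln p%:r * p%:r^-1 ^+ j).
    by rewrite !mulr_ge0 ?ler0n ?ln_nat_ge0 // exprn_ge0 // invr_ge0.
  have S0 : 0 <= \sum_(2 <= p < N.+1) \sum_(2 <= j < N.+1)
      (n == (p ^ j)%N)%:R * (ln p%:r * p%:r^-1 ^+ j).
    by rewrite !sumr_ge0 // => p _; rewrite sumr_ge0.
  case: ifP => // npr; have [E|n1] := eqVneq n 1%N.
    by rewrite [X in Lambda X]E /mangoldt /= mul0r.
  have {}n1 : (1 < n)%N by lia.
  have [p [a [m [pp /andP[m0 mn] pm nE]]]] := pfactor_split n1.
  have [m1|m1] := leqP m 1; last by rewrite nE mangoldt_pfactor_eq0 // mul0r -nE.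
  have {m0 m1 pm mn} m1 : m = 1%N by lia.
  rewrite {}m1 muln1 in nE.
  have a0 : (0 < a)%N.
    by case: a nE npr => // nE; rewrite nE expn1 pp.
  have pN : (p <= N)%N.
    by apply: leq_trans (nN : (n <= N)%N); rewrite nE -{1}(expn1 p) leq_exp2l // prime_gt1.
  have aN : (a.+1 <= N)%N.
    by apply: leq_trans (nN : (n <= N)%N); rewrite nE ltnW // ltn_expl // prime_gt1.
  rewrite (bigD1_seq p) ?iota_uniq ?mem_index_iota ?prime_gt1 //=.
  have aj : (2 <= a.+1 < N.+1)%N by lia.
  rewrite (bigD1_seq a.+1) ?iota_uniq ?mem_index_iota ?aj //=.
  rewrite -nE eqxx mul1r {1}nE mangoldt_pfactor // nE natrX exprVn -addrA lerDl.
  by rewrite -nE addr_ge0 ?sumr_ge0 // => q _; rewrite sumr_ge0.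
rewrite exchange_big_nat /=.
apply: (@le_trans _ _ (\sum_(2 <= p < N.+1) 2 * (ln p%:r * p%:r^-1 ^+ 2))); last first.
  by rewrite -mulr_sumr; have := sum_ln_sqr_le N.+1; lra.
rewrite big_nat [leRHS]big_nat; apply: ler_sum => p /andP[p2 _].
rewrite exchange_big_nat /=.
apply: (@le_trans _ _ (\sum_(2 <= j < N.+1) ln p%:r * p%:r^-1 ^+ j)).
  apply: ler_sum => j _; rewrite -mulr_suml ler_piMl //.
    by rewrite mulr_ge0 ?ln_nat_ge0 // exprn_ge0 // invr_ge0.
  rewrite -natr_sum lern1 -big_mkcond /= sum1_count.
  by rewrite count_uniq_mem ?iota_uniq // leq_b1.
rewrite -mulr_sumr mulrCA ler_wpM2l ?ln_nat_ge0 // geometric_tail_le //.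
by rewrite invr_ge0 ler0n /= lef_pV2 ?posrE ?ltr0n ?ler_nat //; lia.
Qed.

End PrimePowers.

(** * The value at 1 of the series of a balanced function *)

Section BalancedSeries.
Variables (R : realType) (k : nat).
Hypothesis k0 : (0 < k)%N.
Implicit Types (f g : nat -> R) (d m n N p : nat).
Local Notation "n %:r" := (n%:R : R) (at level 1, left associativity, format "n %:r").

(** Real functions on the unit group of Z/k, extended by 0 to all integers. *)
Definition residue_fun f :=
  (forall n, f (n %% k)%N = f n) /\ (forall n, ~~ coprime n k -> f n = 0).

Definition balanced f := residue_fun f /\ \sum_(i < k) f i = 0.

Definition harmonic_sum f N := \sum_(1 <= n < N.+1) f n / n%:r.

Definition mass f := \sum_(i < k) `|f i|.

(** The sum of the series of f n / n.  For balanced f the tail after N is at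
    most [2 * mass f / N.+1] in absolute value, so the partial sums lowered by
    this bound never exceed the sum, and it is their supremum. *)
Definition lvalue f := sup (range (fun N => harmonic_sum f N - 2 * mass f / N.+1%:r)).

Lemma mass_ge0 f : 0 <= mass f.
Proof. by rewrite sumr_ge0. Qed.

Lemma eq0_of_le_inv (x C : R) : (forall N, `|x| <= C / N.+1%:r) -> x = 0.
Proof.
move=> H; apply/eqP; rewrite -normr_le0 leNgt; apply/negP => x0.
have C0 : 0 <= C.
  by have := le_trans (normr_ge0 x) (H 0%N); rewrite divr1.
have := archi_boundP (divr_ge0 C0 (normr_ge0 x)); set n := Num.bound _.
rewrite ltr_pdivrMr // => L; have := H n; rewrite ler_pdivlMr ?ltr0n // leNgt.
by rewrite (lt_le_trans L) // mulrC ler_wpM2l // ler_nat.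
Qed.

Lemma balanced_partial_sum_le f n : balanced f ->
  `|\sum_(0 <= i < n) f i| <= mass f.
Proof.
move=> [[fp _] f0].
have P q r : \sum_(0 <= i < q * k + r) f i = \sum_(0 <= i < r) f i.
  elim: q => [|q IH]; first by rewrite add0n.
  rewrite mulSn -addnA (big_cat_nat (n := k)) ?leq_addr //= big_mkord f0 add0r.
  rewrite -[X in \sum_(X <= _ < _) _]add0n [(k + _)%N]addnC big_addn addnK -IH.
  by apply: eq_bigr => i _; rewrite -fp modnDr fp.
rewrite (divn_eq n k) P; apply: le_trans (ler_norm_sum _ _ _) _.
rewrite /mass -(big_mkord xpredT (fun i => `|f i|)).
rewrite [leRHS](big_cat_nat (n := (n %% k)%N)) //= ?lerDl ?sumr_ge0 //.
by rewrite ltnW // ltn_pmod.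
Qed.

Lemma harmonic_sum_tail f M N : balanced f -> (N <= M)%N ->
  `|harmonic_sum f M - harmonic_sum f N| <= 2 * mass f / N.+1%:r.
Proof.
move=> bf NM; rewrite /harmonic_sum (big_cat_nat (n := N.+1)) //= addrAC subrr add0r.
apply: (abel_bound (w := fun n => n%:r^-1)) => [n|n Nn|n Nn].
- exact: balanced_partial_sum_le.
- by rewrite lef_pV2 ?posrE ?ltr0n ?ler_nat //; apply: leq_trans Nn.
- by rewrite invr_ge0.
Qed.

Lemma lvalue_dist f N : balanced f ->
  `|harmonic_sum f N - lvalue f| <= 2 * mass f / N.+1%:r.
Proof.
move=> bf.
have H M K : harmonic_sum f M - 2 * mass f / M.+1%:r <= harmonic_sum f K + 2 * mass f / K.+1%:r.
  have C0 n : 0 <= 2 * mass f / n.+1%:r by rewrite !mulr_ge0 ?mass_ge0.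
  have [MK|/ltnW KM] := leqP M K.
    have := harmonic_sum_tail bf MK; rewrite ler_norml => /andP[L _].
    move: L (C0 K); set x := _ / M.+1%:r; set y := _ / K.+1%:r; lra.
  have := harmonic_sum_tail bf KM; rewrite ler_norml => /andP[_ L].
  move: L (C0 M); set x := _ / M.+1%:r; set y := _ / K.+1%:r; lra.
move: H; set e := fun N => 2 * mass f / N.+1%:r => H.
rewrite -[2 * mass f / _]/(e N).
rewrite ler_norml; apply/andP; split.
  have : lvalue f <= harmonic_sum f N + e N.
    apply: ge_sup; first by exists (harmonic_sum f 0 - e 0%N), 0%N.
    by move=> _ [M _ <-].
  lra.
have : harmonic_sum f N - e N <= lvalue f.
  apply: ub_le_sup; last by exists N.
  by exists (harmonic_sum f 0 + e 0%N) => _ [M _ <-].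
lra.
Qed.

Lemma lvalue_unique f (l C : R) : balanced f ->
  (forall N, `|harmonic_sum f N - l| <= C / N.+1%:r) -> lvalue f = l.
Proof.
move=> bf H; apply/eqP; rewrite -subr_eq0; apply/eqP.
apply: (@eq0_of_le_inv _ (2 * mass f + C)) => N.
rewrite -[X in `|X|](subrK (harmonic_sum f N)) -addrAC mulrDl.
rewrite [X in `|X|](_ : _ = - (harmonic_sum f N - lvalue f) + (harmonic_sum f N - l)); last by ring.
by apply: le_trans (ler_normD _ _) _; rewrite normrN lerD ?lvalue_dist.
Qed.

Lemma balanced_lin (I : finType) (c : I -> R) (F : I -> nat -> R) :
  (forall i, balanced (F i)) -> balanced (fun n => \sum_i c i * F i n).
Proof.
move=> bF; split; first split.
- by move=> n; apply: eq_bigr => i _; have [[-> _] _] := bF i.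
- by move=> n nk; rewrite big1 // => i _; have [[_ F0] _] := bF i; rewrite F0 // mulr0.
- rewrite exchange_big big1 //= => i _.
  by rewrite -mulr_sumr; have [_ ->] := bF i; rewrite mulr0.
Qed.

Lemma lvalue_lin (I : finType) (c : I -> R) (F : I -> nat -> R) :
  (forall i, balanced (F i)) ->
  lvalue (fun n => \sum_i c i * F i n) = \sum_i c i * lvalue (F i).
Proof.
move=> bF; apply: (@lvalue_unique _ _ (\sum_i `|c i| * (2 * mass (F i)))).
  exact: balanced_lin.
move=> N; have -> : harmonic_sum (fun n => \sum_i c i * F i n) N =
    \sum_i c i * harmonic_sum (F i) N.
  under [RHS]eq_bigr do rewrite mulr_sumr.
  rewrite exchange_big /=; apply: eq_bigr => n _.
  by rewrite mulr_suml; apply: eq_bigr => i _; rewrite mulrA.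
rewrite -sumrB mulr_suml; apply: le_trans (ler_norm_sum _ _ _) _.
by apply: ler_sum => i _; rewrite -mulrBr normrM -mulrA ler_wpM2l // lvalue_dist.
Qed.

End BalancedSeries.

(** * Real characters do not vanish at 1 *)

Section RealCharacter.
Variable R : realType.
Implicit Types (d m n N p : nat).
Local Notation "n %:r" := (n%:R : R) (at level 1, left associativity, format "n %:r").

Section CharacterDivisorSums.
Variable chi : nat -> R.
Hypothesis chiM : forall m n, chi (m * n)%N = chi m * chi n.
Hypothesis chi1 : chi 1%N = 1.
Hypothesis chiV : forall n, [\/ chi n = 0, chi n = 1 | chi n = -1].

Let chiX p j : chi (p ^ j)%N = chi p ^+ j.
Proof. by elim: j => [|j IH]; rewrite ?expn0 ?chi1 // expnS chiM IH exprS. Qed.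

Let geo x a : [\/ x = 0, x = 1 | x = -1 :> R] ->
  (~~ odd a)%:R <= \sum_(j < a.+1) x ^+ j.
Proof.
case=> ->.
- rewrite big_ord_recl big1 => [|j _]; last by rewrite exprS mul0r.
  by rewrite addr0 lern1 leq_b1.
- under eq_bigr do rewrite expr1n.
  by rewrite sumr_const card_ord ler_nat; case: odd.
- elim: a => [|a IH]; first by rewrite big_ord1.
  suff -> : \sum_(j < a.+2) (-1) ^+ j = (~~ odd a.+1)%:R :> R by [].
  elim: a {IH} => [|a IH]; first by rewrite big_ord_recr big_ord1 /= expr1 subrr.
  by rewrite big_ord_recr IH /= -signr_odd /= !negbK; case: odd; rewrite ?expr1 ?expr0 ?add0r ?subrr.
Qed.

(** The divisor sum is multiplicative; at p^a it is the sum of the chi(p)^j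
    for j <= a, which is nonnegative, and at least 1 when a is even. *)
Lemma character_divisor_sum n : (0 < n)%N ->
  0 <= \sum_(d <- divisors n) chi d /\
  ((forall p, ~~ odd (logn p n)) -> 1 <= \sum_(d <- divisors n) chi d).
Proof.
elim/ltn_ind: n => n IH n0; have [->|n1] := eqVneq n 1%N.
  by rewrite big_seq1 chi1.
have {}n1 : (1 < n)%N by lia.
have [p [a [m [pp /andP[m0 mn] pm nE]]]] := pfactor_split n1.
have -> : \sum_(d <- divisors n) chi d =
    (\sum_(j < a.+2) chi p ^+ j) * \sum_(d <- divisors m) chi d.
  rewrite nE sum_divisors_pfactor // mulr_suml; apply: eq_bigr => j _.
  by rewrite mulr_sumr; apply: eq_bigr => d _; rewrite chiM chiX.
have [A0 A1] := IH m mn m0; have G := geo a.+1 (chiV p).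
have G0 : 0 <= \sum_(j < a.+2) chi p ^+ j by apply: le_trans G.
split; first by rewrite mulr_ge0.
move=> ev; have lE q : logn q n = (logn q (p ^ a.+1) + logn q m)%N.
  by rewrite nE lognM // expn_gt0 prime_gt0.
have := ev p; rewrite lE pfactorK // logn_notdvd // addn0 => eva.
rewrite eva in G; rewrite -[leLHS]mulr1 ler_pM //; apply: A1 => q.
have := ev q; rewrite lE lognX logn_prime //.
by case: (eqVneq q p) => [->|]; rewrite ?muln0 ?add0n // logn_notdvd.
Qed.

End CharacterDivisorSums.

Section Lambert.
Variable s : R.
Hypothesis s01 : 0 < s < 1.
Let s0 : 0 < s. Proof. by case/andP: s01. Qed.
Let s1 : s < 1. Proof. by case/andP: s01. Qed.

Let X0 n : 0 < s ^+ n. Proof. by rewrite exprn_gt0. Qed.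
Let X1 n : s ^+ n <= 1. Proof. by rewrite exprn_ile1 ?ltW. Qed.

(** This is the inequality of arithmetic and geometric means for
    1, s^2, ..., s^(2n), whose sum is (1 - s^(2n+2)) / (1 - s^2).  The parameter
    of the Lambert series is written t = s^2 to have the half-integral powers
    of t. *)
Lemma one_sub_pow_ge n : n.+1%:r * (1 - s ^+ 2) * s ^+ n <= 1 - s ^+ (n.+1).*2.
Proof.
elim: n => [|n IH]; first by rewrite expr0 mulr1 mul1r.
have -> : s ^+ n.+2.*2 = s ^+ (n.+1).*2 * s ^+ 2 by rewrite -exprD addn2.
have E : s ^+ (n.+1).*2 = s ^+ n * s ^+ n * s ^+ 2.
  by rewrite -!exprD -addnn -addn1; congr (_ ^+ _); lia.
have -> : n.+2%:r = n.+1%:r + 1 by rewrite natr1.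
have := ler_wpM2l (ltW s0) IH; rewrite E [s ^+ n.+1]exprS.
have : s * s ^+ n <= 1 by rewrite -exprS X1.
have : s * (s * s ^+ n) <= 1 by rewrite -!exprS X1.
set x := s ^+ n; move=> ssx1 sx1 H.
have : 0 <= (1 - s) * (1 - s * x) * (1 - s * (s * x)).
  by rewrite !mulr_ge0 // subr_ge0 // ltW.
move: H; lra.
Qed.

Let t := s ^+ 2.

(** As t tends to 1, t^n / (1 - t^n) is close to 1 / (n (1 - t)).  The gap is
    monotone in n and remains bounded, while both terms blow up. *)
Definition lambert_gap n := (n%:r * (1 - t))^-1 - t ^+ n / (1 - t ^+ n).

Let t1 : t < 1. Proof. by rewrite /t expr_lt1 // ltW. Qed.
Let t0 : 0 < t. Proof. exact: X0. Qed.
Let tn1 n : t ^+ n.+1 < 1. Proof. by rewrite exprn_ilt1 // ltW. Qed.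

(** After clearing denominators this says
    n (n+1) (1 - t)^2 t^n <= (1 - t^n) (1 - t^(n+1)), a product of two instances
    of [one_sub_pow_ge]. *)
Lemma lambert_gap_dec n : (0 < n)%N -> lambert_gap n.+1 <= lambert_gap n.
Proof.
case: n => // m _; rewrite /lambert_gap.
have A := one_sub_pow_ge m; have B := one_sub_pow_ge m.+1.
rewrite -mul2n exprM in A; rewrite -mul2n exprM in B.
rewrite -/t in A B; have q0 : 0 < 1 - t by rewrite subr_gt0.
have u0 : 0 < 1 - t ^+ m.+1 by rewrite subr_gt0.
have v0 : 0 < 1 - t ^+ m.+2 by rewrite subr_gt0.
have n0 : 0 < m.+1%:r by rewrite ltr0n.
have n0' : 0 < m.+2%:r by rewrite ltr0n.
have nE : m.+2%:r = m.+1%:r + 1 by rewrite natr1.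
have C : m.+1%:r * m.+2%:r * (1 - t) ^+ 2 * t ^+ m.+1 <= (1 - t ^+ m.+1) * (1 - t ^+ m.+2).
  apply: (@le_trans _ _ (m.+1%:r * (1 - t) * s ^+ m * (m.+2%:r * (1 - t) * s ^+ m.+1))).
    have -> : m.+1%:r * (1 - t) * s ^+ m * (m.+2%:r * (1 - t) * s ^+ m.+1) =
       m.+1%:r * m.+2%:r * (1 - t) ^+ 2 * (s ^+ m * s ^+ m.+1) by ring.
    rewrite ler_wpM2l //; first by rewrite !mulr_ge0 ?exprn_ge0 ?ltW.
    rewrite /t -exprM -exprD ler_wiXn2l // ?ltW //; lia.
  by rewrite ler_pM // !mulr_ge0 ?ltW.
rewrite -subr_ge0.
have -> : (m.+1%:r * (1 - t))^-1 - t ^+ m.+1 / (1 - t ^+ m.+1) -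
  ((m.+2%:r * (1 - t))^-1 - t ^+ m.+2 / (1 - t ^+ m.+2)) =
  ((1 - t ^+ m.+1) * (1 - t ^+ m.+2) - m.+1%:r * m.+2%:r * (1 - t) ^+ 2 * t ^+ m.+1) /
  (m.+1%:r * m.+2%:r * (1 - t) * (1 - t ^+ m.+1) * (1 - t ^+ m.+2)).
  move: u0 v0 n0'; rewrite [t ^+ m.+2]exprS nE => u0 v0 n0'.
  by field; rewrite !gt_eqF.
by rewrite divr_ge0 ?subr_ge0 // !mulr_ge0 // ltW.
Qed.

Lemma lambert_gap_ge0 n : (0 < n)%N -> 0 <= lambert_gap n.
Proof.
case: n => // m _; rewrite /lambert_gap.
have A := one_sub_pow_ge m; rewrite -mul2n exprM -/t in A.
have q0 : 0 < 1 - t by rewrite subr_gt0.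
have u0 : 0 < 1 - t ^+ m.+1 by rewrite subr_gt0.
rewrite subr_ge0 ler_pdivrMr // mulrC ler_pdivlMr ?mulr_gt0 ?ltr0n //.
apply: le_trans A; rewrite mulrC ler_wpM2l //; first by rewrite mulr_ge0 // ltW.
rewrite /t -exprM ler_wiXn2l // ?ltW //; lia.
Qed.

Lemma lambert_gap1 : lambert_gap 1 = 1.
Proof.
rewrite /lambert_gap expr1 mul1r -[X in X - _]mul1r -mulrBl divff //.
by rewrite gt_eqF // subr_gt0.
Qed.

(** When [lvalue f = 0] the main term [harmonic_sum f N / (1 - t)] is bounded
    as soon as N exceeds 1 / (1 - t); the rest is Abel summation against the
    gaps. *)
Lemma lambert_sum_le k f N : (0 < k)%N -> balanced k f -> lvalue k f = 0 ->
  1 <= N.+1%:r * (1 - t) ->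
  \sum_(1 <= n < N.+1) f n * (t ^+ n / (1 - t ^+ n)) <= 4 * mass k f.
Proof.
move=> k0 bf L0 NL.
have -> : \sum_(1 <= n < N.+1) f n * (t ^+ n / (1 - t ^+ n)) =
   harmonic_sum f N / (1 - t) - \sum_(1 <= n < N.+1) f n * lambert_gap n.
  rewrite mulr_suml -sumrB; apply: eq_bigr => n _.
  by rewrite /lambert_gap invfM; ring.
have := @abel_bound R f lambert_gap (mass k f) 1 N.+1.
move=> /(_ (fun n => balanced_partial_sum_le k0 n bf) lambert_gap_dec lambert_gap_ge0).
rewrite lambert_gap1 mulr1 ler_norml => /andP[lb _].
have := lvalue_dist k0 N bf; rewrite L0 subr0 ler_norml => /andP[_ ub].
have q0 : 0 < 1 - t by rewrite subr_gt0.
have : harmonic_sum f N / (1 - t) <= 2 * mass k f.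
  rewrite ler_pdivrMr //; apply: le_trans ub _.
  rewrite ler_pdivrMr ?ltr0n // -mulrA ler_peMr ?mulr_ge0 ?mass_ge0 //.
  by rewrite mulrC.
lra.
Qed.

(** The power series of the divisor sums is the Lambert series of chi.  The
    cubic condition on N makes the truncation of the geometric series at
    e <= N / d cost at most 1. *)
Lemma character_power_sum_le k chi N : (0 < k)%N -> balanced k chi -> lvalue k chi = 0 ->
  (forall n, `|chi n| <= 1) ->
  1 <= N%:r * (1 - t) ^+ 3 ->
  \sum_(1 <= n < N.+1) (\sum_(d <- divisors n) chi d) * t ^+ n <= 4 * mass k chi + 1.
Proof.
move=> k0 bf L0 c1 NL; have q0 : 0 < 1 - t by rewrite subr_gt0.
have q1 : 1 - t <= 1 by rewrite gerBl ltW.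
have N0 : (0 < N)%N by case: N NL => //; rewrite mul0r ler10.
have NL' : 1 <= N.+1%:r * (1 - t).
  apply: le_trans NL _; rewrite ler_pM ?ler_nat ?exprn_ge0 ?(ltW q0) //.
  by rewrite exprS ler_piMr ?(ltW q0) // exprn_ile1 // ltW.
have := lambert_sum_le k0 bf L0 NL'.
have -> : \sum_(1 <= n < N.+1) (\sum_(d <- divisors n) chi d) * t ^+ n =
   \sum_(1 <= d < N.+1) chi d * \sum_(1 <= e < (N %/ d).+1) (t ^+ d) ^+ e.
  under [RHS]eq_bigr do rewrite mulr_sumr.
  rewrite -(sum_divisors_exchange (fun d e => chi d * (t ^+ d) ^+ e)).
  apply: eq_big_nat => n /andP[n0 _]; rewrite mulr_suml big_seq [RHS]big_seq.
  apply: eq_bigr => d; rewrite -dvdn_divisors // => dn.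
  by rewrite -exprM mulnC divnK.
suff : \sum_(1 <= d < N.+1) chi d * \sum_(1 <= e < (N %/ d).+1) (t ^+ d) ^+ e -
   \sum_(1 <= n < N.+1) chi n * (t ^+ n / (1 - t ^+ n)) <= 1 by lra.
rewrite -sumrB; apply: le_trans (ler_norm _) _; apply: le_trans (ler_norm_sum _ _ _) _.
apply: (@le_trans _ _ (\sum_(1 <= d < N.+1) t ^+ N / (1 - t))).
  rewrite big_nat [leRHS]big_nat; apply: ler_sum => d /andP[d0 dN].
  rewrite -mulrBr normrM -[leRHS]mul1r ler_pM //.
  have td : t ^+ d < 1 by case: (d) d0.
  have td0 : 0 < 1 - t ^+ d by rewrite subr_gt0.
  have G E : \sum_(1 <= e < E.+1) (t ^+ d) ^+ e = (t ^+ d - t ^+ d * (t ^+ d) ^+ E) / (1 - t ^+ d).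
    elim: E => [|E IH]; first by rewrite big_geq // expr0 mulr1 subrr mul0r.
    by rewrite big_nat_recr //= IH [(t ^+ d) ^+ E.+1]exprS; field; rewrite gt_eqF.
  rewrite G -mulrBl addrAC subrr add0r mulNr normrN ger0_norm; last first.
    by rewrite divr_ge0 ?(ltW td0) // mulr_ge0 // !exprn_ge0 // ltW.
  rewrite ler_pM ?invr_ge0 ?(ltW td0) ?mulr_ge0 ?exprn_ge0 ?(ltW t0) ?(ltW s0) //.
    rewrite -exprM -exprD ler_wiXn2l ?(ltW t0) ?(ltW t1) //.
    by rewrite {1}(divn_eq N d) mulnC addnC leq_add2r ltnW // ltn_pmod.
  rewrite lef_pV2 ?posrE // lerD2l lerN2.
  by rewrite -[leRHS]expr1 ler_wiXn2l ?(ltW t0) ?(ltW t1).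
rewrite sumr_const_nat subn1 /= -mulr_natr mulrAC ler_pdivrMr // mul1r.
have := one_sub_pow_ge N.-1; rewrite prednK //; set y := s ^+ N.-1 => A.
have {}A : N%:r * (1 - t) * y <= 1 by apply: le_trans A _; rewrite gerBl ltW.
have n0 : 0 < N%:r by rewrite ltr0n.
have y0 : 0 < y by exact: X0.
have ty : t ^+ N <= y ^+ 2.
  rewrite /t /y -!exprM ler_wiXn2l ?(ltW s0) ?(ltW s1) //; lia.
have z0 : 0 < N%:r * (1 - t) ^+ 2 by rewrite mulr_gt0 // exprn_gt0.
rewrite -(ler_pM2l z0); apply: (@le_trans _ _ ((N%:r * (1 - t) * y) ^+ 2)).
  have -> : (N%:r * (1 - t) * y) ^+ 2 = N%:r * (1 - t) ^+ 2 * (y ^+ 2 * N%:r) by ring.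
  by rewrite ler_wpM2l ?(ltW z0) // ler_wpM2r // ltW.
apply: (@le_trans _ _ 1); first by rewrite exprn_ile1 // !mulr_ge0 // ltW.
by rewrite -mulrA -exprSr.
Qed.

End Lambert.

(** Bernoulli's inequality, used to choose t close enough to 1. *)
Lemma bernoulli_half M : (0 < M)%N -> 2^-1 <= (1 - (2 * M%:r)^-1) ^+ M.
Proof.
move=> M0; have M0' : 1 <= M%:r by rewrite ler1n.
set e := (2 * M%:r)^-1.
have e0 : 0 < e by rewrite invr_gt0; lra.
have eM : M%:r * e = 2^-1 by rewrite /e; field; rewrite gt_eqF //; lra.
have e1 : e <= 1 by nra.
suff H n : 1 - n%:r * e <= (1 - e) ^+ n by have := H M; rewrite eM; lra.
elim: n => [|n IH]; first by rewrite mul0r subr0 expr0.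
rewrite exprS; have e1' : 0 <= 1 - e by lra.
have := ler_wpM2l e1' IH; have -> : n.+1%:r = n%:r + 1 by rewrite natr1.
have : 0 <= n%:r by rewrite ler0n.
move=> ? ?; nra.
Qed.

Theorem real_character_lvalue_neq0 k (chi : nat -> R) : (0 < k)%N -> balanced k chi ->
  (forall m n, chi (m * n)%N = chi m * chi n) -> chi 1%N = 1 ->
  (forall n, [\/ chi n = 0, chi n = 1 | chi n = -1]) -> lvalue k chi <> 0.
Proof.
move=> k0 bf chiM chi1 chiV L0.
pose B := 2 * (4 * mass k chi + 1).
have B0 : 0 <= B by rewrite mulr_ge0 // addr_ge0 // mulr_ge0 // mass_ge0.
have := archi_boundP B0; set J := Num.bound B => BJ.
have J0 : (0 < J)%N by rewrite -(ltr0n R); exact: le_lt_trans BJ.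
pose M := (2 * J ^ 2)%N.
have M0 : (0 < M)%N by rewrite muln_gt0 expn_gt0 J0.
have M0' : 1 <= M%:r by rewrite ler1n.
have := bernoulli_half M0; set s := 1 - _ => sM.
have s01 : 0 < s < 1.
  rewrite /s subr_gt0 gtrBl invr_gt0 invf_lt1; last by lra.
  by apply/andP; split; lra.
(* with this t, the weights t^(j^2) of the squares j^2 <= J^2 are at least 1/2 *)
have [s0 s1] := andP s01; set t := s ^+ 2.
have t0 : 0 < t by rewrite exprn_gt0.
have t1 : t < 1 by rewrite /t expr_lt1 // ltW.
have tJ : 2^-1 <= t ^+ (J ^ 2) by rewrite /t -exprM.
have q0 : 0 < 1 - t by rewrite subr_gt0.
have q3 : 0 <= (1 - t) ^- 3 by rewrite invr_ge0 exprn_ge0 // ltW.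
have := archi_boundP q3; set N1 := Num.bound _ => HN1.
pose N := (J ^ 2 + N1)%N.
have HN : 1 <= N%:r * (1 - t) ^+ 3.
  rewrite -ler_pdivrMr ?exprn_gt0 // mul1r; apply: le_trans (ltW HN1) _.
  by rewrite ler_nat leq_addl.
have cn n : `|chi n| <= 1.
  by case: (chiV n) => ->; rewrite ?normrN ?normr0 ?normr1.
have := character_power_sum_le s01 k0 bf L0 cn HN.
rewrite -/t leNgt => /negP; apply.
set A := fun n => \sum_(d <- divisors n) chi d.
have A0 n : (0 < n)%N -> 0 <= A n.
  by move=> n0; have [] := character_divisor_sum chiM chi1 chiV n0.
have A1 n : (0 < n)%N -> 1 <= A (n ^ 2)%N.
  move=> n0; have [|_ ->] // := character_divisor_sum chiM chi1 chiV (n := (n ^ 2)%N).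
    by rewrite expn_gt0 n0.
  by move=> p; rewrite lognX oddM.
have pos m n : (0 < m)%N -> 0 <= \sum_(m <= i < n) A i * t ^+ i.
  move=> m0; rewrite big_nat sumr_ge0 // => i /andP[mi _].
  by rewrite mulr_ge0 ?exprn_ge0 ?A0 // ?(leq_trans m0) // ltW.
apply: (@lt_le_trans _ _ (J%:r * 2^-1)); first by move: BJ; rewrite /B; lra.
rewrite (big_cat_nat (n := (J ^ 2).+1)) //; last by rewrite ltnS leq_addr.
rewrite -[leLHS]addr0 lerD ?pos //.
suff H j : (j <= J)%N -> j%:r * 2^-1 <= \sum_(1 <= i < (j ^ 2).+1) A i * t ^+ i.
  exact: H.
elim: j => [|j IH] jJ; first by rewrite mul0r pos.
have jj : (j ^ 2 < j.+1 ^ 2)%N by rewrite ltn_exp2r.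
rewrite (big_cat_nat (n := (j ^ 2).+1)) //; last by rewrite ltnS ltnW.
have -> : j.+1%:r * 2^-1 = j%:r * 2^-1 + 2^-1 :> R by rewrite -natr1; ring.
apply: lerD; first by apply: IH; exact: ltnW.
rewrite big_nat_recr // -[leLHS]add0r lerD ?pos //.
rewrite -[leLHS]mul1r ler_pM ?A1 //; apply: le_trans tJ _.
by rewrite ler_wiXn2l ?(ltW t0) ?(ltW t1) // leq_exp2r.
Qed.

End RealCharacter.

(** * Bounded sequences *)

Section BoundedSequences.
Variable R : realType.
Implicit Types u v : nat -> R.

Definition bdd u := exists C, forall N, `|u N| <= C.

Lemma bddD u v : bdd u -> bdd v -> bdd (fun N => u N + v N).
Proof.
move=> [C uC] [D vD]; exists (C + D) => N.
by apply: le_trans (ler_normD _ _) _; rewrite lerD.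
Qed.

Lemma bddZ (c : R) u : bdd u -> bdd (fun N => c * u N).
Proof. by move=> [C uC]; exists (`|c| * C) => N; rewrite normrM ler_wpM2l. Qed.

Lemma bddB u v : bdd u -> bdd v -> bdd (fun N => u N - v N).
Proof.
move=> bu /(bddZ (-1)) bv; have [C uC] := bddD bu bv.
by exists C => N; rewrite -mulN1r.
Qed.

Lemma bdd_sum (I : finType) (F : I -> nat -> R) :
  (forall i, bdd (F i)) -> bdd (fun N => \sum_i F i N).
Proof.
move=> /choice[C FC]; exists (\sum_i C i) => N.
by apply: le_trans (ler_norm_sum _ _ _) _; apply: ler_sum.
Qed.

Lemma bdd_eq u v : (forall N, u N = v N) -> bdd u -> bdd v.
Proof. by move=> uv [C uC]; exists C => N; rewrite -uv. Qed.

Lemma bdd_between u C D : (forall N, C <= u N) -> (forall N, u N <= D) -> bdd u.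
Proof.
move=> uC uD; exists (`|C| + `|D|) => N; rewrite ler_norml; apply/andP; split.
  by apply: le_trans (uC N); have := ler_norm (- C); have := normr_ge0 D;
    rewrite normrN; lra.
by apply: le_trans (uD N) _; have := ler_norm D; have := normr_ge0 C; lra.
Qed.

Lemma bddN_ln : ~ bdd (fun N => ln N%:R : R).
Proof.
move=> [C H]; have C0 := ltW (expR_gt0 C).
have := archi_boundP C0; set n := Num.bound _ => Hn.
have n0 : 0 < n%:R :> R by apply: le_lt_trans Hn.
have : C < ln n%:R by rewrite -[C]expRK ltr_ln ?posrE ?expR_gt0.
by rewrite ltNge (le_trans (ler_norm _) (H n)).
Qed.

End BoundedSequences.

(** * The transform of balanced functions by their L-values *)

Section Kernel.
Variables (R : realType) (k : nat).
Hypothesis k0 : (0 < k)%N.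
Implicit Types (f g w : nat -> R) (d m n N p : nat).
Local Notation "n %:r" := (n%:R : R) (at level 1, left associativity, format "n %:r").
Local Notation Lambda := (mangoldt R).
Local Notation mu := (moebius R).

Definition dilate d f := fun n => f (d * n)%N.
Definition mangoldt_sum f N := \sum_(1 <= n < N.+1) f n * (Lambda n / n%:r).
(** On functions on the unit group this is the convolution operator by the
    weights 1/n; a character is an eigenvector, of eigenvalue L(1, chi). *)
Definition ltransform f := fun d => lvalue k (dilate d f).

Lemma sum_residues_dilate d g : coprime d k -> (forall n, g (n %% k)%N = g n) ->
  \sum_(i < k) g (d * i)%N = \sum_(i < k) g i.
Proof.
move=> dk gp; pose h (i : 'I_k) := Ordinal (ltn_pmod (d * i) k0).
have hinj : injective h.
  move=> i j /(congr1 val) /= /eqP E; apply: val_inj => /=.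
  move: E; wlog ij : i j / (i <= j)%N => [W|].
    by case/orP: (leq_total i j) => ij E; [exact: W | symmetry; apply: W => //; rewrite eq_sym].
  rewrite eq_sym eqn_mod_dvd ?leq_mul2l ?ij ?orbT // -mulnBr Gauss_dvdr 1?coprime_sym //.
  move=> /dvdn_leq; have := ltn_ord j; lia.
rewrite [RHS](reindex h) /=; last exact: onW_bij (injF_bij hinj).
by apply: eq_bigr => i _; rewrite gp.
Qed.

Lemma dilate_noncoprime d f : residue_fun k f -> ~~ coprime d k -> dilate d f = fun=> 0.
Proof.
move=> [_ f0] dk; apply/funext => n; rewrite /dilate f0 //.
by rewrite coprimeMl (negbTE dk).
Qed.

Lemma residue_dilate d f : residue_fun k f -> residue_fun k (dilate d f).
Proof.
move=> [fp f0]; split=> n; first by rewrite /dilate -fp modnMmr fp.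
by move=> nk; rewrite /dilate f0 // coprimeMl (negbTE nk) andbF.
Qed.

Lemma balanced0 : balanced k (fun=> 0 : R).
Proof. by split; [split|rewrite big1]. Qed.

Lemma balanced_dilate d f : balanced k f -> balanced k (dilate d f).
Proof.
move=> [rf sf]; have [dk|dk] := boolP (coprime d k).
  split; first exact: residue_dilate.
  by rewrite /dilate sum_residues_dilate //; case: rf.
by rewrite dilate_noncoprime //; exact: balanced0.
Qed.

Lemma mass_dilate d f : residue_fun k f -> mass k (dilate d f) <= mass k f.
Proof.
move=> rf; have [dk|dk] := boolP (coprime d k).
  rewrite /mass /dilate (sum_residues_dilate (g := fun n => `|f n|)) //.
  by move=> n; have [-> _] := rf.
rewrite dilate_noncoprime // /mass big1 ?sumr_ge0 // => i _.
by rewrite normr0.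
Qed.

Lemma lvalue0 : lvalue k (fun=> 0 : R) = 0.
Proof.
apply: (@lvalue_unique _ _ k0 _ _ 0) => [|N]; first exact: balanced0.
by rewrite subr0 /harmonic_sum big1 ?normr0 ?mul0r // => n _; rewrite mul0r.
Qed.

Lemma lvalueZ (c : R) f : balanced k f -> balanced k (fun n => c * f n) /\
  lvalue k (fun n => c * f n) = c * lvalue k f.
Proof.
move=> bf; have E : (fun n => \sum_(i < 1) c * f n) = (fun n => c * f n).
  by apply/funext => n; rewrite big_ord1.
split; rewrite -E; first exact: (@balanced_lin R k _ (fun=> c) (fun=> f)).
by rewrite (lvalue_lin k0 (fun=> c) (F := fun=> f)) // big_ord1.
Qed.

Lemma ltransform_noncoprime f d : residue_fun k f -> ~~ coprime d k -> ltransform f d = 0.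
Proof. by move=> rf dk; rewrite /ltransform dilate_noncoprime // lvalue0. Qed.

Lemma balanced_ltransform f : balanced k f -> balanced k (ltransform f).
Proof.
move=> bf; have [rf sf] := bf; split; first split.
- move=> n; congr (lvalue k _); apply/funext => i; rewrite /dilate.
  by have [fp _] := rf; rewrite -fp modnMml fp.
- by move=> n; exact: ltransform_noncoprime.
- have <- : lvalue k (fun n => \sum_(i < k) 1 * dilate i f n) = \sum_(i < k) ltransform f i.
    rewrite (lvalue_lin k0 (fun=> 1) (F := fun i : 'I_k => dilate i f)) => [|i].
      by apply: eq_bigr => i _; rewrite mul1r.
    exact: balanced_dilate.
  rewrite -[RHS]lvalue0; congr (lvalue k _); apply/funext => n.
  under eq_bigr do rewrite mul1r /dilate mulnC.
  have [nk|nk] := boolP (coprime n k).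
    by rewrite sum_residues_dilate //; have [] := rf.
  by rewrite big1 // => i _; have [_ f0] := rf; rewrite f0 // coprimeMl (negbTE nk).
Qed.

Lemma lvalue_dilate_dist f d N : balanced k f -> (0 < d)%N -> (0 < N)%N ->
  `|harmonic_sum (dilate d f) (N %/ d) - ltransform f d| <= 2 * mass k f * d%:r / N%:r.
Proof.
move=> bf d0 N0; apply: le_trans (lvalue_dist k0 _ (balanced_dilate d bf)) _.
rewrite -!mulrA ler_wpM2l // ler_pM ?mass_ge0 //; first by apply: mass_dilate; case: bf.
rewrite -[leLHS]mul1r ler_pdivrMr ?ltr0n // mulrAC ler_pdivlMr ?ltr0n // mul1r.
by rewrite -natrM ler_nat mulnC ltnW // -ltn_divLR.
Qed.

(** Write ln n as the divisor sum of Lambda in the sum of f(n) ln n / n.  The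
    sum over n = d e with d fixed is [ltransform f d] up to O(d / N), and the
    errors add up to O(1) by [chebyshev_le]. *)
Lemma mangoldt_sum_ltransform f : balanced k f -> bdd (mangoldt_sum (ltransform f)).
Proof.
move=> bf; pose D N := \sum_(1 <= d < N.+1)
  Lambda d / d%:r * (harmonic_sum (dilate d f) (N %/ d) - ltransform f d).
(* unlike ln n / n, the weight (ln n + 1) / n decreases from n = 1 on *)
pose A N := \sum_(1 <= n < N.+1) f n * ((ln n%:r + 1) / n%:r).
apply: (@bdd_eq _ (fun N => A N - harmonic_sum f N - D N)).
  move=> N; rewrite /A /D /harmonic_sum -sumrB.
  have -> : \sum_(1 <= i < N.+1) (f i * ((ln i%:r + 1) / i%:r) - f i / i%:r) =
      \sum_(1 <= d < N.+1) Lambda d / d%:r * harmonic_sum (dilate d f) (N %/ d).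
    under [RHS]eq_bigr do rewrite /harmonic_sum mulr_sumr.
    rewrite -(sum_divisors_exchange
      (fun d e => Lambda d / d%:r * (dilate d f e / e%:r))).
    apply: eq_big_nat => n /andP[n0 _].
    transitivity (f n / n%:r * \sum_(d <- divisors n) Lambda d).
      by rewrite sum_mangoldt //; ring.
    rewrite mulr_sumr big_seq [RHS]big_seq; apply: eq_bigr => d.
    rewrite -dvdn_divisors // => dn; rewrite /dilate mulnC divnK //.
    have nE : n%:r = d%:r * (n %/ d)%:r by rewrite -natrM mulnC divnK.
    by rewrite nE invfM; ring.
  rewrite -sumrB; apply: eq_bigr => d _; rewrite /harmonic_sum; ring.
apply: bddB; first apply: bddB.
- exists (2 * mass k f * ((ln 1 + 1) / 1%:r)) => N.
  apply: (abel_bound (w := fun n => (ln n%:r + 1) / n%:r)) => [n|n n0|n n0].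
  + exact: balanced_partial_sum_le.
  + rewrite ler_pdivrMr ?ltr0n // mulrAC ler_pdivlMr ?ltr0n //.
    have n0' : 0 < n%:r by rewrite ltr0n.
    have -> : n.+1%:r = n%:r + 1 by rewrite natr1.
    have H := ln_succ_le R n0; have := ln_nat_ge0 R n => L0.
    have : n%:r * ln n.+1%:r <= n%:r * ln n%:r + 1.
      apply: le_trans (ler_wpM2l (ltW n0') H) _.
      by rewrite mulrDr divff // gt_eqF.
    have -> : n.+1%:r = n%:r + 1 by rewrite natr1.
    lra.
  + by rewrite divr_ge0 // addr_ge0 // ln_nat_ge0.
- exists (2 * mass k f / 1%:r) => N.
  by have := harmonic_sum_tail k0 bf (leq0n N); rewrite {2}/harmonic_sum big_geq // subr0.
- exists (8 * mass k f) => N; have m0 := mass_ge0 k f.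
  have [->|N0] := posnP N; first by rewrite /D big_geq // normr0 mulr_ge0.
  apply: le_trans (ler_norm_sum _ _ _) _.
  apply: (@le_trans _ _ (\sum_(1 <= d < N.+1) Lambda d * (2 * mass k f / N%:r))).
    rewrite big_nat [leRHS]big_nat; apply: ler_sum => d /andP[d0 _].
    have d0' : 0 < d%:r by rewrite ltr0n.
    rewrite normrM ger0_norm ?divr_ge0 ?mangoldt_ge0 //.
    rewrite -[leLHS]mulrA ler_wpM2l ?mangoldt_ge0 //.
    apply: le_trans (ler_wpM2l _ (lvalue_dilate_dist bf d0 N0)) _.
      by rewrite invr_ge0 ltW.
    rewrite (_ : d%:r^-1 * _ = 2 * mass k f / N%:r) //.
    by field; rewrite !gt_eqF ?ltr0n.
  rewrite -mulr_suml; have N0' : 0 < N%:r by rewrite ltr0n.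
  rewrite mulrA ler_pdivrMr //.
  have := ler_wpM2r (mulr_ge0 (ler0n R 2) m0) (chebyshev_le R N).
  by lra.
Qed.

Lemma sum_divisors_swap n (g : nat -> nat -> R) : (0 < n)%N ->
  \sum_(d <- divisors n) \sum_(e <- divisors (n %/ d)) g d e =
  \sum_(e <- divisors n) \sum_(d <- divisors (n %/ e)) g d e.
Proof.
have E (h : nat -> nat -> R) : (0 < n)%N -> \sum_(d <- divisors n) \sum_(e <- divisors (n %/ d)) h d e =
    \sum_(1 <= d < n.+1) \sum_(1 <= e < n.+1 | (d * e %| n)%N) h d e.
  move=> n0; rewrite (sum_divisors_le _ (N := n)) ?n0 ?leqnn //.
  rewrite big_mkcond big_nat [RHS]big_nat; apply: eq_bigr => d /andP[d0 dN].
  case: ifP => dn; last first.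
    by rewrite big1 // => e de; rewrite (dvdn_trans (dvdn_mulr _ (dvdnn d)) de) in dn.
  rewrite (sum_divisors_le _ (N := n)); last first.
    by rewrite divn_gt0 // -ltnS dN leq_div.
  by apply: eq_bigl => e; rewrite dvdn_divRL // mulnC.
move=> n0; rewrite E // (E (fun e d => g d e)) // (exchange_big_dep xpredT) //=.
by apply: eq_bigr => d _; apply: eq_bigl => e; rewrite mulnC.
Qed.

Lemma mangoldt_moebius n : (0 < n)%N ->
  \sum_(d <- divisors n) mu d * ln (n %/ d)%:r = Lambda n.
Proof.
move=> n0.
transitivity (\sum_(d <- divisors n) \sum_(e <- divisors (n %/ d)) mu d * Lambda e).
  rewrite big_seq [RHS]big_seq; apply: eq_bigr => d; rewrite -dvdn_divisors // => dn.
  by rewrite -mulr_sumr sum_mangoldt // divn_gt0 ?(dvdn_gt0 n0 dn) // dvdn_leq.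
rewrite sum_divisors_swap //.
rewrite (bigD1_seq n) ?divisors_uniq ?divisors_id //= divnn n0 big_seq1 mul1r.
rewrite big_seq_cond big1 ?addr0 // => e; rewrite -dvdn_divisors // => /andP[en ne].
have e0 := dvdn_gt0 n0 en.
have ne0 : (0 < n %/ e)%N by rewrite divn_gt0 // dvdn_leq.
rewrite -mulr_suml sum_moebius //.
case: eqP => [q1|_]; last by rewrite mul0r.
by case/eqP: ne; rewrite -(divnK en) q1 mul1n.
Qed.

(** For a character chi this says L(1, chi) = 0. *)
Definition lkernel f := balanced k f /\ forall d, ltransform f d = 0.

(** Here Lambda n is replaced by the divisor sum of mu d (ln N - ln d), which
    is Lambda n for n > 1 and ln N for n = 1.  As the L-values vanish, the inner
    sums are O(d / N), and the sum of ln N - ln d over d <= N is at most N. *)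
Lemma mangoldt_sum_lkernel f : lkernel f ->
  bdd (fun N => mangoldt_sum f N + f 1%N * ln N%:r).
Proof.
move=> [bf Lf]; have m0 := mass_ge0 k f; exists (2 * mass k f) => N.
have [->|N0] := posnP N.
  by rewrite /mangoldt_sum big_geq // ln0 // mulr0 add0r normr0 mulr_ge0.
have N0' : 0 < N%:r by rewrite ltr0n.
have -> : mangoldt_sum f N + f 1%N * ln N%:r =
    \sum_(1 <= d < N.+1) mu d / d%:r * (ln N%:r - ln d%:r) *
       harmonic_sum (dilate d f) (N %/ d).
  under [RHS]eq_bigr do rewrite /harmonic_sum mulr_sumr.
  rewrite -(sum_divisors_exchange
      (fun d e => mu d / d%:r * (ln N%:r - ln d%:r) * (dilate d f e / e%:r))).
  have -> : f 1%N * ln N%:r = \sum_(1 <= n < N.+1) f n / n%:r * ((n == 1%N)%:R * (ln N%:r - ln n%:r)).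
    rewrite (bigD1_seq 1%N) ?iota_uniq ?mem_index_iota //= ?eqxx ln1 mul1r subr0 divr1.
    by rewrite big1 ?addr0 // => n /negbTE ->; rewrite mul0r mulr0.
  rewrite -big_split /=; apply: eq_big_nat => n /andP[n0 _].
  rewrite -(mangoldt_moebius n0) -sum_moebius //.
  rewrite [X in X + _](_ : _ = f n / n%:r *
    \sum_(d <- divisors n) mu d * ln (n %/ d)%:r); last by ring.
  rewrite -mulrDr mulr_suml -big_split mulr_sumr big_seq [RHS]big_seq.
  apply: eq_bigr => d; rewrite -dvdn_divisors // => dn; rewrite /dilate mulnC divnK //.
  have d0 := dvdn_gt0 n0 dn; have e0 : (0 < n %/ d)%N by rewrite divn_gt0 // dvdn_leq.
  have nE : n%:r = d%:r * (n %/ d)%:r by rewrite -natrM mulnC divnK.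
  rewrite {1 2}nE lnM ?posrE ?ltr0n // invfM; rewrite /=; ring.
apply: le_trans (ler_norm_sum _ _ _) _.
apply: (@le_trans _ _ (\sum_(1 <= d < N.+1) (2 * mass k f / N%:r) * (ln N%:r - ln d%:r))).
  rewrite big_nat [leRHS]big_nat; apply: ler_sum => d /andP[d0 dN].
  have d0' : 0 < d%:r by rewrite ltr0n.
  have L0 : 0 <= ln N%:r - ln d%:r by rewrite subr_ge0 ln_nat_mono.
  have := lvalue_dilate_dist bf d0 N0; rewrite Lf subr0 => H.
  rewrite !normrM (ger0_norm L0) mulrAC ler_wpM2r //.
  rewrite normfV (ger0_norm (ltW d0')).
  have -> : 2 * mass k f / N%:r = 1 / d%:r * (2 * mass k f * d%:r / N%:r).
    by field; rewrite !gt_eqF.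
  by rewrite ler_pM ?mulr_ge0 ?invr_ge0 ?(ltW d0') // ler_wpM2r ?invr_ge0 ?(ltW d0') // moebius_le1.
rewrite -mulr_sumr sumrB sumr_const_nat subn1 /= -mulr_natl.
rewrite mulrAC ler_pdivrMr // ler_wpM2l ?mulr_ge0 //.
by have := sum_ln_ge R N; lra.
Qed.

End Kernel.

(** * Injectivity of the transform *)

Section Dirichlet.
Variables (R : realType) (k : nat).
Hypothesis k0 : (0 < k)%N.
Implicit Types (f g h w : nat -> R) (d m n N p u : nat).
Local Notation "n %:r" := (n%:R : R) (at level 1, left associativity, format "n %:r").
Local Notation Lambda := (mangoldt R).

Definition unit_ind n : R := (coprime n k)%:R.
Definition class_ind u n : R := (n == u %[mod k])%:R.

Lemma unit_ind_mod n : unit_ind (n %% k) = unit_ind n.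
Proof. by rewrite /unit_ind coprime_modl. Qed.

Lemma mangoldt_weight_ge0 n : 0 <= Lambda n / n%:r.
Proof. by rewrite divr_ge0 ?mangoldt_ge0. Qed.

Lemma mangoldt_sum_ge0 f N : (forall n, 0 <= f n) -> 0 <= mangoldt_sum f N.
Proof.
by move=> f0; rewrite sumr_ge0 // => n _; rewrite mulr_ge0 // mangoldt_weight_ge0.
Qed.

Lemma class_ind_ge0 u n : 0 <= class_ind u n. Proof. exact: ler0n. Qed.

Lemma mangoldt_sum_classes f N : (forall n, f (n %% k)%N = f n) ->
  mangoldt_sum f N = \sum_(u < k) f u * mangoldt_sum (class_ind u) N.
Proof.
move=> fp; under [RHS]eq_bigr do rewrite mulr_sumr.
rewrite exchange_big; apply: eq_bigr => n _ /=.
rewrite (bigD1 (Ordinal (ltn_pmod n k0))) //= {1}/class_ind modn_mod eqxx mul1r fp.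
rewrite big1 ?addr0 // => u un; rewrite /class_ind.
case: eqP => [E|_]; last by rewrite mul0r mulr0.
by move: un; rewrite -val_eqE /= E modn_small ?eqxx.
Qed.

(** From [mertens_ge], discarding the prime powers and the primes dividing k. *)
Lemma unit_mangoldt_sum_ge : exists C, forall N, (0 < N)%N ->
  ln N%:r - C <= \sum_(1 <= n < N.+1 | prime n && coprime n k) Lambda n / n%:r.
Proof.
exists (\sum_(1 <= n < k.+1) Lambda n / n%:r + 9) => N N0.
have := mertens_ge R N0; rewrite (bigID prime) /=.
have := sum_mangoldt_nonprime_le R N.
have : \sum_(1 <= n < N.+1 | prime n) Lambda n / n%:r =
    \sum_(1 <= n < N.+1 | prime n && coprime n k) Lambda n / n%:r +
    \sum_(1 <= n < N.+1 | prime n && ~~ coprime n k) Lambda n / n%:r.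
  by rewrite (bigID (fun n => coprime n k)).
have : \sum_(1 <= n < N.+1 | prime n && ~~ coprime n k) Lambda n / n%:r <=
       \sum_(1 <= n < k.+1) Lambda n / n%:r.
  apply: (@le_trans _ _ (\sum_(1 <= n < N.+1 | (n < k.+1)%N) Lambda n / n%:r)).
    rewrite big_mkcond [leRHS]big_mkcond /=; apply: ler_sum => n _.
    case: ifP => [/andP[pn nk]|_]; last by case: ifP => // _; exact: mangoldt_weight_ge0.
    rewrite prime_coprime // negbK in nk.
    by rewrite ltnS dvdn_leq.
  have [Nk|kN] := leqP N k.
    rewrite [leRHS](big_cat_nat (n := N.+1)) //= -[leLHS]addr0 lerD //.
      rewrite big_mkcond /=; apply: ler_sum => n _.
      by case: ifP => // _; exact: mangoldt_weight_ge0.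
    by rewrite sumr_ge0 // => n _; exact: mangoldt_weight_ge0.
  by rewrite -(big_nat_widen 1 k.+1 N.+1 xpredT) // ltnS ltnW.
by lra.
Qed.

Lemma mangoldt_sum_unit_ge : exists C, forall N, (0 < N)%N ->
  ln N%:r - C <= mangoldt_sum unit_ind N.
Proof.
have [C H] := unit_mangoldt_sum_ge; exists C => N N0; apply: le_trans (H N N0) _.
rewrite big_mkcond /=; apply: ler_sum => n _; rewrite /unit_ind.
have := mangoldt_weight_ge0 n.
by case: coprime; rewrite ?andbF ?mul0r // mul1r; case: prime.
Qed.

Lemma mangoldt_sum_unit_le N : mangoldt_sum unit_ind N <= ln N%:r + 4.
Proof.
have [->|N0] := posnP N; first by rewrite /mangoldt_sum big_geq // ln0.
apply: le_trans (mertens_le R N0); apply: ler_sum => n _.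
by rewrite ler_piMl ?mangoldt_weight_ge0 // lern1 leq_b1.
Qed.

Lemma mangoldt_sum_unit_nbdd : ~ bdd (mangoldt_sum unit_ind).
Proof.
move=> [D H]; have [C HC] := mangoldt_sum_unit_ge; apply: (@bddN_ln R).
apply: (@bdd_between _ _ (- (`|C| + D)) (`|C| + D)) => N.
  have := ln_nat_ge0 R N; have := normr_ge0 C; have := le_trans (normr_ge0 _) (H N).
  lra.
have [->|N0] := posnP N.
  rewrite ln0 //; have := normr_ge0 C; have := le_trans (normr_ge0 _) (H 0%N); lra.
have := HC N N0; have := le_trans (ler_norm _) (H N); have := ler_norm C; lra.
Qed.

(** A posteriori every unit class is rich. *)
Definition rich_class p := coprime p k /\ ~ bdd (mangoldt_sum (class_ind p)).

(** The autocorrelation h(n) = sum_i f(i) f(i n) lies in the kernel with f, so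
    its Mangoldt sum is - h(1) ln N + O(1).  In the function
    sum_i (f(i) + f(i n))^2 = 2 h(1) + 2 h(n) this cancels the logarithm of
    the constant term; a nonnegative function with bounded Mangoldt sums
    vanishes at every rich class. *)
Lemma lkernel_rich f p n : lkernel k f -> rich_class p -> f (p * n)%N = - f n.
Proof.
move=> kf [pk pB]; have [bf Lf] := kf; have [[fp f0] _] := bf.
pose h n := \sum_(i < k) f i * f (i * n)%N.
pose q n := unit_ind n * \sum_(i < k) (f i + f (i * n)%N) ^+ 2.
have bh : balanced k h.
  have -> : h = (fun n => \sum_(i < k) f i * dilate i f n) by [].
  by apply: balanced_lin => i; exact: balanced_dilate.
have kh : lkernel k h.
  split => // d; rewrite /ltransform.
  have -> : dilate d h = (fun n => \sum_(i < k) f i * dilate (i * d) f n).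
    by apply/funext => m; apply: eq_bigr => i _; rewrite /dilate mulnA.
  rewrite (lvalue_lin k0 (fun i : 'I_k => f i) (F := fun i => dilate (i * d) f)) => [|i].
    by rewrite big1 // => i _; rewrite [X in _ * X](Lf (i * d)%N) mulr0.
  exact: balanced_dilate.
have q0 m : 0 <= q m.
  by rewrite mulr_ge0 ?ler0n // sumr_ge0 // => i _; rewrite sqr_ge0.
have qE m : q m = 2 * (h 1%N * unit_ind m) + 2 * h m.
  rewrite /q; have [mk|mk] := boolP (coprime m k); last first.
    by have [[_ h0] _] := bh; rewrite (h0 m mk) /unit_ind (negbTE mk) mul0r !mulr0 addr0.
  rewrite /unit_ind mk mul1r mulr1.
  have -> : \sum_(i < k) (f i + f (i * m)%N) ^+ 2 =
      \sum_(i < k) f i ^+ 2 + 2 * h m + \sum_(i < k) f (i * m)%N ^+ 2.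
    by rewrite mulr_sumr -!big_split; apply: eq_bigr => i _ /=; ring.
  have -> : \sum_(i < k) f (i * m)%N ^+ 2 = h 1%N.
    under eq_bigr do rewrite mulnC.
    rewrite (sum_residues_dilate k0 (g := fun n => f n ^+ 2) mk) => [|i]; last by rewrite fp.
    by apply: eq_bigr => i _; rewrite muln1 expr2.
  have -> : \sum_(i < k) f i ^+ 2 = h 1%N.
    by apply: eq_bigr => i _; rewrite muln1 expr2.
  by ring.
have Tq : bdd (mangoldt_sum q).
  have [C HC] := mangoldt_sum_lkernel k0 kh.
  have h0 : 0 <= h 1%N.
    by rewrite sumr_ge0 // => i _; rewrite muln1 -expr2 sqr_ge0.
  apply: (@bdd_between _ _ 0 (2 * (h 1%N * 4) + 2 * C)) => N; first exact: mangoldt_sum_ge0.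
  have -> : mangoldt_sum q N = 2 * (h 1%N * mangoldt_sum unit_ind N) + 2 * mangoldt_sum h N.
    rewrite /mangoldt_sum !mulr_sumr -big_split /=; apply: eq_bigr => m _.
    by rewrite qE; ring.
  have := le_trans (ler_norm _) (HC N).
  have := ler_wpM2l h0 (mangoldt_sum_unit_le N); rewrite mulrDr; lra.
have qper m : q (m %% k)%N = q m.
  rewrite /q unit_ind_mod; congr (_ * _); apply: eq_bigr => i _.
  by rewrite -[f (i * (m %% k))%N]fp modnMmr fp.
have qp : q p = 0.
  apply/eqP/negPn/negP => qp; apply: pB.
  have qp0 : 0 < q p by rewrite lt_neqAle eq_sym qp q0.
  have [C HC] := Tq.
  apply: (@bdd_between _ _ 0 (C / q p)) => N.
    by apply: mangoldt_sum_ge0; exact: class_ind_ge0.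
  rewrite ler_pdivlMr // mulrC; apply: le_trans (HC N).
  apply: le_trans (ler_norm _); rewrite (mangoldt_sum_classes N qper).
  rewrite (bigD1 (Ordinal (ltn_pmod p k0))) //= qper.
  have -> : mangoldt_sum (class_ind (p %% k)) N = mangoldt_sum (class_ind p) N.
    by apply: eq_bigr => m _; rewrite /class_ind modn_mod.
  rewrite lerDl sumr_ge0 // => i _; rewrite mulr_ge0 //.
  by apply: mangoldt_sum_ge0; exact: class_ind_ge0.
move: qp; rewrite /q /unit_ind pk mul1r => /eqP.
rewrite psumr_eq0 => [/allP H|i _]; last exact: sqr_ge0.
have := H (Ordinal (ltn_pmod n k0)) (mem_index_enum _).
rewrite /= sqrf_eq0 fp -[f (_ * _)%N]fp modnMml fp mulnC addrC addr_eq0.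
by move/eqP.
Qed.

Lemma exists_rich_class : exists p, rich_class p.
Proof.
apply: contrapT => H; apply: mangoldt_sum_unit_nbdd.
apply: (@bdd_eq _ (fun N => \sum_(u < k) unit_ind u * mangoldt_sum (class_ind u) N)).
  by move=> N; rewrite -mangoldt_sum_classes // => n; exact: unit_ind_mod.
apply: bdd_sum => u; rewrite /unit_ind; have [uk|_] := boolP (coprime u k); last first.
  by exists 0 => N; rewrite mul0r normr0.
by apply: bddZ; apply: contrapT => uB; apply: H; exists u.
Qed.

(** The transform of w is constant on the rich classes, which carry all of
    the unbounded part of Mangoldt sums, so boundedness of
    [mangoldt_sum (ltransform w)] forces this constant [ltransform w 1] to be 0.
    The same holds for the dilates of w, so w is in the kernel, and
    [lkernel_rich] gives w = - w. *)
Lemma rich_invariant_eq0 w : balanced k w ->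
  (forall p n, rich_class p -> w (p * n)%N = w n) -> forall n, w n = 0.
Proof.
have at1 (v : nat -> R) : balanced k v -> (forall p n, rich_class p -> v (p * n)%N = v n) ->
    ltransform k v 1 = 0.
  move=> bv inv; apply/eqP/negPn/negP => L1; apply: mangoldt_sum_unit_nbdd.
  have [[Lp L0] _] := balanced_ltransform k0 bv.
  apply: (@bdd_eq _ (fun N => (ltransform k v 1)^-1 * (mangoldt_sum (ltransform k v) N -
     \sum_(u < k) (ltransform k v u - ltransform k v 1 * unit_ind u) * mangoldt_sum (class_ind u) N))).
    move=> N; rewrite (mangoldt_sum_classes _ Lp).
    rewrite (mangoldt_sum_classes _ unit_ind_mod) -sumrB mulr_sumr.
    by apply: eq_bigr => u _; field.
  apply: bddZ; apply: bddB; first exact: mangoldt_sum_ltransform.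
  apply: bdd_sum => u; rewrite /unit_ind.
  have [uk|uk] := boolP (coprime u k); last first.
    by exists 0 => N; rewrite L0 // mulr0 subrr mul0r normr0.
  have [B|B] := pselect (bdd (mangoldt_sum (class_ind u))); first exact: bddZ.
  exists 0 => N; rewrite /ltransform.
  have -> : dilate u v = v by apply/funext => m; rewrite /dilate inv.
  have -> : dilate 1 v = v by apply/funext => m; rewrite /dilate mul1n.
  by rewrite mulr1 subrr mul0r normr0.
move=> bw inv n.
have kw : lkernel k w.
  split=> // d; have [dk|dk] := boolP (coprime d k); last first.
    by apply: ltransform_noncoprime => //; case: bw.
  have := @at1 (dilate d w) (balanced_dilate k0 d bw).
  rewrite /ltransform.
  have -> : dilate 1 (dilate d w) = dilate d w by apply/funext => m; rewrite /dilate mul1n.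
  by apply=> p m rp; rewrite /dilate mulnCA inv.
have [p rp] := exists_rich_class.
have := lkernel_rich n kw rp; rewrite inv // => /eqP.
by rewrite -addr_eq0 -mulr2n mulrn_eq0 /= => /eqP.
Qed.

(** The products f(n) f(g n), less their mean over the units, are invariant
    under the rich classes because the two signs cancel.  So they are constant
    in n, and this makes f / f(1) a character with values 1 and -1. *)
Theorem lkernel_trivial f : lkernel k f -> forall n, f n = 0.
Proof.
move=> kf u; apply: contrapT => /eqP fu; have [bf Lf] := kf; have [[fp f0] _] := bf.
have s0 : 0 < \sum_(i < k) unit_ind i.
  apply: lt_le_trans (ltr01) _; rewrite (bigD1 (Ordinal (ltn_pmod 1 k0))) //=.
  by rewrite unit_ind_mod /unit_ind coprime1n lerDl sumr_ge0 // => i _; rewrite ler0n.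
pose c (a : nat) := (\sum_(i < k) f i * f (a * i)%N) / \sum_(i < k) unit_ind i.
have fE (g n : nat) : f n * f (g * n)%N = c g * unit_ind n.
  apply/eqP; rewrite -subr_eq0; apply/eqP; move: n.
  apply: (@rich_invariant_eq0 (fun n => f n * f (g * n)%N - c g * unit_ind n)).
    split; first split.
    - by move=> n; rewrite unit_ind_mod fp -[f (g * (n %% k))%N]fp modnMmr fp.
    - by move=> n nk; rewrite f0 // /unit_ind (negbTE nk) mul0r mulr0 subrr.
    - by rewrite sumrB -mulr_sumr /c divfK ?subrr // gt_eqF.
  move=> p n rp; rewrite mulnCA !(lkernel_rich _ kf rp) mulrNN; congr (_ - _ * _).
  by have [pk _] := rp; rewrite /unit_ind coprimeMl pk.
have c1 : c 1%N != 0.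
  have := fE 1%N u; rewrite mul1n; apply: contra_eqN => /eqP ->; rewrite mul0r.
  by rewrite mulf_neq0.
have f1 : f 1%N * f 1%N = c 1%N by have := fE 1%N 1%N; rewrite /unit_ind coprime1n mulr1.
have f10 : f 1%N != 0 by apply: contraNneq c1 => E; rewrite -f1 E mulr0.
have f2 n : coprime n k -> f n * f n = f 1%N * f 1%N.
  by move=> nk; have := fE 1%N n; rewrite mul1n /unit_ind nk mulr1 f1.
have fM m n : coprime n k -> f n * f (m * n)%N = f 1%N * f m.
  move=> nk; have := fE m n; rewrite /unit_ind nk => ->.
  by have := fE m 1%N; rewrite muln1 /unit_ind coprime1n => ->.
have [bc Lc] := lvalueZ k0 (f 1%N)^-1 bf.
apply: (real_character_lvalue_neq0 k0 bc).
- move=> m n; have [nk|nk] := boolP (coprime n k); last first.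
    by rewrite (f0 n nk) (f0 (m * n)%N) ?coprimeMl ?(negbTE nk) ?andbF // !mulr0.
  have fn : f n != 0 by apply: contraNneq c1 => E; rewrite -f1 -(f2 n) // E mulr0.
  apply: (mulfI fn); rewrite [LHS]mulrCA fM // mulKf //.
  transitivity ((f n * f n) * f m / (f 1%N * f 1%N)); last by field.
  by rewrite f2 //; field.
- by rewrite mulVf.
- move=> n; have [nk|nk] := boolP (coprime n k); last by apply: Or31; rewrite (f0 n nk) mulr0.
  have : ((f 1%N)^-1 * f n) ^+ 2 == 1.
    by rewrite exprMn expr2 [f n ^+ 2]expr2 f2 //; apply/eqP; field.
  by rewrite sqrf_eq1 => /orP[]/eqP ->; [apply: Or32 | apply: Or33].
- rewrite Lc; have := Lf 1%N; rewrite /ltransform.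
  have -> : dilate 1 f = f by apply/funext => m; rewrite /dilate mul1n.
  by move=> ->; rewrite mulr0.
Qed.

(** * Dirichlet's theorem *)

Definition unit_count : R := \sum_(i < k) unit_ind i.

Lemma unit_count_gt0 : 0 < unit_count.
Proof.
apply: lt_le_trans (ltr01) _; rewrite /unit_count (bigD1 (Ordinal (ltn_pmod 1 k0))) //=.
by rewrite unit_ind_mod /unit_ind coprime1n lerDl sumr_ge0 // => i _; rewrite ler0n.
Qed.

(** The function equal to 1 at the class u and 0 at the other units, less its
    mean.  These functions span the balanced functions. *)
Definition centered_class u n : R := unit_ind n * (class_ind u n - unit_ind u / unit_count).

Lemma sum_class_ind f n : \sum_(i < k) f i * class_ind i n = f (n %% k)%N.
Proof.
rewrite (bigD1 (Ordinal (ltn_pmod n k0))) //= /class_ind modn_mod eqxx mulr1.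
rewrite big1 ?addr0 // => i ni; case: eqP => [E|_]; last by rewrite mulr0.
by move: ni; rewrite -val_eqE /= E modn_small ?eqxx.
Qed.

Lemma balanced_centered_class u : balanced k (centered_class u).
Proof.
split; first split.
- by move=> n; rewrite /centered_class unit_ind_mod /class_ind modn_mod.
- by move=> n nk; rewrite /centered_class /unit_ind (negbTE nk) mul0r.
- rewrite /centered_class; under eq_bigr do rewrite mulrBr.
  rewrite sumrB -mulr_suml -/unit_count [X in _ - X]mulrC divfK ?gt_eqF ?unit_count_gt0 //.
  have -> : \sum_(i < k) unit_ind i * class_ind u i = \sum_(i < k) unit_ind i * class_ind i u.
    by apply: eq_bigr => i _; rewrite /class_ind eq_sym.
  by rewrite sum_class_ind unit_ind_mod subrr.
Qed.

Lemma centered_class_expand f n : balanced k f ->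
  \sum_(i < k) f i * centered_class i n = f n.
Proof.
move=> [[fp f0] sf].
have fu i : f i * unit_ind i = f i.
  rewrite /unit_ind; have [|ik] := boolP (coprime i k); first by rewrite mulr1.
  by rewrite f0 // mul0r.
transitivity (unit_ind n * (\sum_(i < k) f i * class_ind i n -
   (\sum_(i < k) f i * unit_ind i) / unit_count)).
  rewrite mulr_suml -sumrB mulr_sumr; apply: eq_bigr => i _.
  by rewrite /centered_class; ring.
have -> : \sum_(i < k) f i * unit_ind i = 0.
  by rewrite -[RHS]sf; apply: eq_bigr => i _; exact: fu.
by rewrite mul0r subr0 sum_class_ind fp mulrC fu.
Qed.

(** An injective endomorphism of a finite-dimensional space is onto. *)
Lemma ltransform_surjective h : balanced k h ->
  exists2 w : nat -> R, balanced k w & forall n, ltransform k w n = h n.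
Proof.
move=> bh.
pose proj (v : 'rV[R]_k) n := \sum_i v 0 i * centered_class i n.
(* The transform on balanced functions, extended by the identity on the kernel
   of the projection [proj]. *)
pose A : 'M[R]_k := \matrix_(i, j)
  (ltransform k (centered_class i) j + (i == j)%:R - centered_class i j).
have bproj v : balanced k (proj v).
  by apply: balanced_lin => i; exact: balanced_centered_class.
have AE v (j : 'I_k) : (v *m A) 0 j = ltransform k (proj v) j + v 0 j - proj v j.
  rewrite mxE.
  have -> : ltransform k (proj v) j = \sum_i v 0 i * ltransform k (centered_class i) j.
    rewrite -(lvalue_lin k0 _ (F := fun i : 'I_k => dilate j (centered_class i))) // => i.
    exact/(balanced_dilate k0)/balanced_centered_class.
  have -> : v 0 j = \sum_i v 0 i * (i == j)%:R.
    rewrite (bigD1 j) //= eqxx mulr1 big1 ?addr0 // => i /negbTE ->.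
    by rewrite mulr0.
  rewrite -big_split -sumrB; apply: eq_bigr => i _ /=; rewrite mxE; ring.
have projA v n : \sum_j (v *m A) 0 j * centered_class j n = ltransform k (proj v) n.
  under eq_bigr do rewrite AE -addrA mulrDl.
  rewrite big_split /= centered_class_expand; last exact: balanced_ltransform.
  under [X in _ + X]eq_bigr do rewrite mulrBl.
  by rewrite sumrB centered_class_expand // -/(proj v n) subrr addr0.
have Au : A \in unitmx.
  rewrite -row_free_unit; apply: inj_row_free => v vA.
  have L0 d : ltransform k (proj v) d = 0.
    by rewrite -projA vA big1 // => j _; rewrite mxE mul0r.
  have P0 := lkernel_trivial (conj (bproj v) L0).
  apply/rowP => j; rewrite mxE; have := AE v j.
  by rewrite vA mxE L0 P0 add0r subr0 => <-.
pose v := (\row_j h j) *m invmx A.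
exists (proj v) => // n; rewrite -projA /v mulmxKV // -[RHS](centered_class_expand n bh).
by apply: eq_bigr => j _; rewrite mxE.
Qed.

Lemma mangoldt_sum_balanced h : balanced k h -> bdd (mangoldt_sum h).
Proof.
move=> bh; have [w bw wh] := ltransform_surjective bh.
apply: bdd_eq (mangoldt_sum_ltransform k0 bw) => N.
by apply: eq_bigr => n _; rewrite wh.
Qed.

Definition prime_in_class u p := prime p && (p == u %[mod k]).

(** The class u receives 1 / phi(k) of the Mangoldt weight of the units, up to
    O(1), because [centered_class u] is balanced; prime powers contribute
    O(1). *)
Lemma sum_prime_class_ge u : coprime u k -> exists c C, 0 < c /\ forall N, (0 < N)%N ->
  c * ln N%:r - C <= \sum_(1 <= p < N.+1 | prime_in_class u p) ln p%:r / p%:r.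
Proof.
move=> uk; have [C HC] := mangoldt_sum_balanced (balanced_centered_class u).
have [D HD] := mangoldt_sum_unit_ge; have c0 := unit_count_gt0.
exists unit_count^-1, (C + D / unit_count + 8); split; first by rewrite invr_gt0.
move=> N N0.
have E : mangoldt_sum (class_ind u) N =
    mangoldt_sum (centered_class u) N + unit_count^-1 * mangoldt_sum unit_ind N.
  rewrite mulr_sumr -big_split /=; apply: eq_bigr => n _.
  have -> : class_ind u n = unit_ind n * class_ind u n.
    rewrite /unit_ind /class_ind; case: eqP => [nu|_]; last by rewrite mulr0.
    have -> : coprime n k by rewrite -coprime_modl nu coprime_modl.
    by rewrite mul1r.
  have uE : unit_ind u = 1 by rewrite /unit_ind uk.
  by rewrite /centered_class uE; ring.
have : mangoldt_sum (class_ind u) N <=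
  \sum_(1 <= p < N.+1 | prime_in_class u p) ln p%:r / p%:r + 8.
  rewrite /mangoldt_sum (bigID prime) /= lerD //.
    rewrite le_eqVlt; apply/orP; left; apply/eqP.
    rewrite big_mkcond [RHS]big_mkcond /=; apply: eq_bigr => p _.
    rewrite /prime_in_class /class_ind; case: (boolP (prime p)) => //= pp.
    by rewrite mangoldt_prime //; case: eqP; rewrite ?mul1r ?mul0r.
  apply: le_trans (sum_mangoldt_nonprime_le R N); apply: ler_sum => n _.
  by rewrite ler_piMl ?mangoldt_weight_ge0 // lern1 leq_b1.
have i0 : 0 <= unit_count^-1 by rewrite invr_ge0 ltW.
rewrite E; have := ler_wpM2l i0 (HD N N0).
have := HC N; rewrite ler_norml => /andP[L _].
rewrite mulrBr [_ * D]mulrC; set x := _ / unit_count; set y := _ * ln _.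
by move=> ? ?; move: L; lra.
Qed.

Lemma ln_lin_nbdd (c C : R) : 0 < c -> ~ forall N, (0 < N)%N -> c * ln N%:r <= C.
Proof.
move=> c0 H; apply: (@bddN_ln R); exists (C / c) => N.
rewrite ger0_norm ?ln_nat_ge0 // ler_pdivlMr // mulrC.
have [->|/H//] := posnP N; rewrite ln0 // mulr0.
by have := H 1%N isT; rewrite ln1 mulr0.
Qed.

Theorem dirichlet u B : coprime u k -> exists p, [/\ prime p, (B < p)%N & p = u %[mod k]].
Proof.
move=> uk; have [c [C [c0 H]]] := sum_prime_class_ge uk.
apply: contrapT => nP.
apply: (@ln_lin_nbdd c (C + \sum_(1 <= p < B.+1) ln p%:r / p%:r)) => // N N0.
have nn p : 0 <= ln p%:r / p%:r by rewrite divr_ge0 // ln_nat_ge0.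
have := H N N0.
suff : \sum_(1 <= p < N.+1 | prime_in_class u p) ln p%:r / p%:r <=
  \sum_(1 <= p < B.+1) ln p%:r / p%:r by lra.
apply: (@le_trans _ _ (\sum_(1 <= p < N.+1 | (p < B.+1)%N) ln p%:r / p%:r)).
  rewrite big_mkcond [leRHS]big_mkcond /=; apply: ler_sum => p _.
  case: ifP => [/andP[pp /eqP pu]|_]; last by case: ifP.
  rewrite ltnS leqNgt; case: ltnP => // Bp.
  by case: nP; exists p.
have [NB|BN] := leqP N B.
  rewrite [leRHS](big_cat_nat (n := N.+1)) //= -[leLHS]addr0 lerD ?sumr_ge0 //.
  by rewrite big_mkcond /=; apply: ler_sum => n _; case: ifP.
by rewrite -(big_nat_widen 1 B.+1 N.+1 xpredT) // ltnS ltnW.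
Qed.

(** If the sum converged, the primes p > y would contribute less than c/2 to
    it for some y, hence less than (c / 2) ln N to the sum of ln p / p up to N,
    where c is the constant of [sum_prime_class_ge]. *)
Theorem sum_inv_primes_nbdd u : coprime u k ->
  ~ bdd (fun N => \sum_(1 <= p < N.+1 | prime_in_class u p) p%:r^-1).
Proof.
move=> uk [D HD]; have [c [C [c0 H]]] := sum_prime_class_ge uk.
pose S N := \sum_(1 <= p < N.+1 | prime_in_class u p) p%:r^-1.
have hs : has_sup (range S).
  split; first by exists (S 0%N), 0%N.
  by exists D => _ [N _ <-]; exact: le_trans (ler_norm _) (HD N).
have c2 : 0 < c / 2 by lra.
have [_ [y _ <-] Sy] := sup_adherent c2 hs.
have Sle N : S N <= sup (range S) by apply: ub_le_sup; [case: hs | exists N].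
pose K := \sum_(1 <= p < y.+1 | prime_in_class u p) ln p%:r / p%:r.
have K0 : 0 <= K by rewrite sumr_ge0 // => p _; rewrite divr_ge0 // ln_nat_ge0.
apply: (@ln_lin_nbdd (c / 2) (C + K)) => // N N0.
have := H N N0.
suff : \sum_(1 <= p < N.+1 | prime_in_class u p) ln p%:r / p%:r <= K + c / 2 * ln N%:r by lra.
have L0 := ln_nat_ge0 R N.
have [Ny|yN] := leqP N y.
  apply: (@le_trans _ _ K); last by rewrite lerDl mulr_ge0 // ltW.
  rewrite /K [leRHS](big_cat_nat (n := N.+1)) //= lerDl sumr_ge0 // => p _.
  by rewrite divr_ge0 // ln_nat_ge0.
rewrite (big_cat_nat (n := y.+1)) //=; last by rewrite ltnS ltnW.
rewrite lerD2l; apply: (@le_trans _ _ (ln N%:r * \sum_(y.+1 <= p < N.+1 | prime_in_class u p) p%:r^-1)).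
  rewrite mulr_sumr big_nat_cond [leRHS]big_nat_cond; apply: ler_sum => p.
  move=> /andP[/andP[p1 p2] _]; rewrite ler_wpM2r ?invr_ge0 // ln_nat_mono //.
  exact: leq_trans p1.
rewrite mulrC ler_wpM2r //.
have := Sle N; rewrite {1}/S (big_cat_nat (n := y.+1)) //=; last by rewrite ltnS ltnW.
by rewrite -/(S y); lra.
Qed.

End Dirichlet.

Import numFieldNormedType.Exports.
Local Open Scope classical_set_scope.
Local Open Scope ring_scope.

(** * Products of primes *)

Section PrimeProducts.
Variable R : realType.
Implicit Types (a : pred nat) (B N p q : nat).

Lemma prime_product_spec {a} B N : (forall p, a p -> prime p) ->
  let Q := (\prod_(B <= p < N | a p) p)%N in
  [/\ (0 < Q)%N,
      forall q, prime q -> (q %| Q)%N -> a q /\ (B <= q < N)%N,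
      forall q, (logn q Q <= 1)%N
    & (totient Q)%:R = Q%:R * \prod_(B <= p < N | a p) (1 - p%:R^-1) :> R].
Proof.
move=> apr; elim: N => [|N IH] /=.
  rewrite !big_geq // mulr1; split=> [//|q pq|q|//]; last by rewrite logn1.
  by rewrite dvdn1 => /eqP q1; rewrite q1 in pq.
have [NB|BN] := ltnP N B.
  rewrite !big_geq // mulr1; split=> [//|q pq|q|//]; last by rewrite logn1.
  by rewrite dvdn1 => /eqP q1; rewrite q1 in pq.
have [/= Q0 Qp Ql Qt] := IH.
rewrite [X in _ * X]big_mkcond big_nat_recr //= -big_mkcond /=.
have -> : (\prod_(B <= p < N.+1 | a p) p =
           \prod_(B <= p < N | a p) p * (if a N then N else 1))%N.
  by rewrite big_mkcond big_nat_recr //= -big_mkcond.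
case: ifP => aN; last first.
  rewrite muln1 mulr1; split=> // q pq /(Qp q pq)[aq /andP[Bq qN]].
  by split=> //; rewrite Bq ltnW.
move: Q0 Qp Ql Qt; set Q := (\prod_(B <= p < N | a p) p)%N => Q0 Qp Ql Qt.
have pN := apr N aN; have N0 := prime_gt0 pN.
have NQ : ~~ (N %| Q)%N by apply/negP => /(Qp N pN)[_]; rewrite ltnn andbF.
split.
- by rewrite muln_gt0 Q0.
- move=> q pq; rewrite Euclid_dvdM // => /orP[/(Qp q pq)[aq /andP[Bq qN]]|].
    by split=> //; rewrite Bq ltnW.
  by rewrite dvdn_prime2 // => /eqP ->; rewrite ltnSn BN.
- move=> q; rewrite lognM // (logn_prime q pN); have [->|_] := eqVneq q N.
    by rewrite logn_notdvd.
  by rewrite addn0.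
- rewrite totient_coprime; last by rewrite coprime_sym prime_coprime.
  rewrite !natrM Qt totient_prime // -subn1 natrB // mulrACA; congr (_ * _).
  by rewrite mulrBr mulr1 divff ?pnatr_eq0 -?lt0n.
Qed.

Lemma squarefree_logn n : (0 < n)%N -> (forall q, (logn q n <= 1)%N) -> squarefree n.
Proof.
move=> n0 H e en; have e0 : (0 < e)%N.
  by case: e en => //; rewrite exp0n // dvd0n => /eqP E; rewrite E in n0.
have [//|e1] := leqP e 1; first by lia.
have pp := pdiv_prime e1.
have : (pdiv e ^ 2 %| n)%N by apply: dvdn_trans en; rewrite dvdn_exp2r // pdiv_dvd.
by rewrite pfactor_dvdn // => L; have := H (pdiv e); lia.
Qed.

(** The partial products start above x, tend to 0 because the sum of the
    1/p diverges, and each factor changes them by at most 1/B < e; so the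
    first one that is at most x is above x - e. *)
Lemma prime_product_dense k (x e : R) B0 : (0 < k)%N -> 0 < x < 1 -> 0 < e ->
  exists B N, (B0 <= B)%N /\
    x - e < \prod_(B <= p < N | prime_in_class k 1 p) (1 - p%:R^-1) <= x.
Proof.
move=> k0 /andP[x0 x1] e0.
have ei0 : 0 <= e^-1 by rewrite invr_ge0 ltW.
have := archi_boundP ei0; set B1 := Num.bound _ => HB1.
pose B := (maxn B0 B1).+2; pose c := prime_in_class k 1.
have Be : B%:R^-1 < e.
  rewrite invf_plt ?posrE ?ltr0n //; apply: lt_trans HB1 _.
  by rewrite ltr_nat /B; lia.
pose P N : R := \prod_(B <= p < N | c p) (1 - p%:R^-1).
have pos p : (B <= p)%N -> 0 <= 1 - p%:R^-1 :> R.
  by move=> Bp; rewrite subr_ge0 invf_le1 ?ler1n ?ltr0n; lia.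
have P0 N : 0 <= P N.
  by rewrite /P big_nat_cond prodr_ge0 // => p /andP[/andP[Bp _] _]; exact: pos.
have ex : exists N, P N <= x.
  have nb := @sum_inv_primes_nbdd R k k0 1 (coprime1n k).
  pose S := \sum_(1 <= p < B | c p) p%:R^-1 : R.
  apply: contrapT => H; apply: nb; exists (S - ln x + 1) => N.
  have S0 : 0 <= S by rewrite sumr_ge0.
  have lx : ln x <= 0 by rewrite ln_le0 // ltW.
  rewrite ger0_norm ?sumr_ge0 //.
  have [NB|BN] := leqP N.+1 B.
    rewrite (@le_trans _ _ S) //; last by lra.
    by rewrite /S [leRHS](big_cat_nat (n := N.+1)) //= lerDl sumr_ge0.
  rewrite (big_cat_nat (n := B)) //=; last exact: ltnW.
  rewrite -/S -addrA lerD2l leNgt; apply/negP => L; apply: H; exists N.+1.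
  apply: (@le_trans _ _ (expR (- \sum_(B <= p < N.+1 | c p) p%:R^-1))).
    rewrite -sumrN expR_sum /P big_nat_cond [leRHS]big_nat_cond.
    apply: ler_prod => p /andP[/andP[Bp _] _]; rewrite pos //=.
    exact: expR_ge1Dx.
  rewrite -[leRHS]lnK ?posrE // ler_expR.
  by move: L; rewrite /c; lra.
have [N PN Nmin] := ex_minnP ex; exists B, N; split; first by rewrite /B; lia.
rewrite -/(P N) PN andbT.
case: N PN Nmin => [|N] PN Nmin.
  by move: PN; rewrite /P big_geq // leNgt x1.
have PN' : x < P N by rewrite ltNge; apply/negP => /Nmin; rewrite ltnn.
have [NB|BN] := ltnP N B.
  by move: PN; rewrite /P big_geq // leNgt x1.
have P1 : P N <= 1.
  suff /andP[] : 0 <= P N <= 1 by [].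
  rewrite /P big_nat_cond; elim/big_ind: _ => [|y z /andP[y0 y1] /andP[z0 z1]|p].
  - by rewrite ler01 lexx.
  - by rewrite mulr_ge0 // mulr_ile1.
  - by move=> /andP[/andP[Bp _] _]; rewrite pos //= gerBl invr_ge0.
rewrite /P big_mkcond big_nat_recr //= -big_mkcond /= -/(P N).
have NBi : N%:R^-1 <= B%:R^-1 :> R by rewrite lef_pV2 ?posrE ?ltr0n ?ler_nat //; lia.
have Ni0 : 0 <= N%:R^-1 :> R by rewrite invr_ge0.
by case: ifP => _; [nra | lra].
Qed.

End PrimeProducts.

(** * Density *)

Lemma eqn_mod_int (x y k : nat) : x = y %[mod k] ->
  exists z : int, x%:Z = y%:Z + k%:Z * z.
Proof.
move=> xy; have /eqP : (x%:Z = y%:Z %[mod k%:Z])%Z by rewrite !modz_nat xy.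
rewrite eqz_mod_dvd => /dvdzP[z E]; exists z.
by rewrite mulrC -E addrC subrK.
Qed.

Lemma gcd_ab_gt0 a m b r : (0 < a)%N -> (0 < m)%N -> (0 < gcd_ab a m b r)%N.
Proof. by move=> a0 m0; rewrite /gcd_ab /gcdz absz_nat gcdn_gt0 abszM muln_gt0 !absz_nat a0 m0. Qed.

(** With s = a r + b, [dirichlet] is applied to the residue of s / g modulo
    a m / g, two coprime numbers.  Then g p = s mod a m, and the factor Q, being
    1 mod a m, does not change the class. *)
Lemma exists_arithmetic_solution (R : realType) (a m : nat) (b r : int) (B Q : nat) :
  (0 < a)%N -> (0 < m)%N -> (0 < Q)%N -> Q = 1 %[mod a * m] ->
  exists p n, [/\ prime p, (B < p)%N, (0 < n)%N,
    (n%:Z = r %[mod m%:Z])%Z &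
    a%:Z * n%:Z + b = (gcd_ab a m b r * Q * p)%N%:Z].
Proof.
move=> a0 m0 Q0 Q1; have g0 := gcd_ab_gt0 b r a0 m0.
set g := gcd_ab a m b r; pose s := a%:Z * r + b.
have gE : g = gcdn (a * m) `|s| by rewrite /g /gcd_ab /gcdz absz_nat abszM.
rewrite -/g in g0; have gam : (g %| a * m)%N by rewrite gE dvdn_gcdl.
have gs : (g%:Z %| s)%Z by rewrite dvdzE absz_nat gE dvdn_gcdr.
pose k := (a * m %/ g)%N; pose u := (s %/ g%:Z)%Z.
have kg : (k * g = a * m)%N by rewrite divnK.
have ug : u * g%:Z = s by rewrite divzK.
have k0 : (0 < k)%N by rewrite divn_gt0 // dvdn_leq // muln_gt0 a0.
have cop : coprime `|u| k.
  rewrite /coprime gcdnC -(eqn_pmul2r g0) muln_gcdl mul1n kg.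
  by rewrite -ug abszM absz_nat in gE; rewrite -gE.
pose v := `|(u %% k%:Z)%Z|%N.
have vE : v%:Z = (u %% k%:Z)%Z by rewrite gez0_abs // modz_ge0 // eqz_nat -lt0n.
have vk : coprime v k.
  move: cop; rewrite /coprime.
  have -> : gcdn `|u| k = `|gcdz u k%:Z|%N by [].
  by rewrite -gcdz_modl.
have [p [pp Bp pv]] := dirichlet R k0 (B + `|b|) vk.
have [z1 pE] := eqn_mod_int pv; have [z3 QE] := eqn_mod_int Q1.
pose z := z1 - (u %/ k%:Z)%Z + g%:Z * z3 * p%:Z.
pose ni := r + m%:Z * z.
have E : a%:Z * ni + b = (g * Q * p)%N%:Z.
  have -> : a%:Z * ni + b = s + (a * m)%N%:Z * z by rewrite /ni /s PoszM; ring.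
  rewrite -kg !PoszM QE /z.
  rewrite -{1}ug {1}(divz_eq u k%:Z) -vE.
  have -> : v%:Z = p%:Z - k%:Z * z1 by rewrite pE; ring.
  by rewrite -kg !PoszM; ring.
have ni0 : 0 < ni.
  have : 0 < a%:Z * ni.
    rewrite -(addrK b (a%:Z * ni)) E subr_gt0.
    apply: le_lt_trans (ler_norm b) _; rewrite -abszE ltz_nat.
    apply: leq_trans (leq_ltn_trans (leq_addl B _) Bp) _.
    by rewrite leq_pmull // muln_gt0 g0.
  by rewrite pmulr_rgt0 // ltz_nat.
have nE : `|ni|%N%:Z = ni by rewrite gez0_abs // ltW.
exists p, `|ni|%N; split => //; first exact: leq_ltn_trans (leq_addr _ _) Bp.
- by rewrite -ltz_nat nE.
- by rewrite nE /ni addrC mulrC modzMDl.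
- by rewrite nE.
Qed.

Lemma prod_eq1_mod k B N :
  (\prod_(B <= p < N | prime_in_class k 1 p) p)%N = 1 %[mod k].
Proof.
apply: (big_ind (fun Q => Q = 1 %[mod k])) => // [x y x1 y1|p /andP[_ /eqP] //].
by rewrite -modnMm x1 y1 modnMm.
Qed.

Lemma bigD_gt0 (R : realType) (a m : nat) (b r : int) (c : R) :
  (0 < a)%N -> (0 < m)%N -> 0 < c -> 0 < bigD a m b r c.
Proof.
move=> a0 m0 c0; have g0 := gcd_ab_gt0 b r a0 m0.
by rewrite /bigD !mulr_gt0 ?invr_gt0 ?ltr0n ?totient_gt0.
Qed.

Lemma phi_ratio_gt0 (R : realType) (a m : nat) (b r : int) (c d : R) n :
  (0 < a)%N -> 0 < c -> setM a m b r c d n -> 0 < phi_ratio a b c d n.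
Proof.
move=> a0 c0 [n0]; rewrite gt_max => /andP[nb nd] _.
have a0' : 0 < a%:R :> R by rewrite ltr0n.
have ab : 0 < a%:Z * n%:Z + b.
  rewrite -(ltr0z R) intrD intrM -!pmulrn.
  move: nb; rewrite -mulNr ltr_pdivrMr // mulrC; lra.
rewrite /phi_ratio divr_gt0 ?ltr0n ?totient_gt0 ?/affine ?absz_gt0 ?gt_eqF //.
by move: nd; rewrite -mulNr ltr_pdivrMr // mulrC; lra.
Qed.

(** The ratio (p - 1) / (p + e) tends to 1 as p grows, at a rate depending
    only on a bound for |e|. *)
Lemma ratio_factor_close (R : realType) (e D eta p : R) :
  0 < D -> 0 < eta -> `|e| + 1 + D * (1 + `|e|) / eta < p ->
  0 < p + e /\ `|D * ((p - 1) / (p + e)) - D| < eta.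
Proof.
move=> D0 eta0 H.
have K0 : 0 <= D * (1 + `|e|) / eta by rewrite !mulr_ge0 ?invr_ge0 ?addr_ge0 // ltW.
have en : - `|e| <= e by rewrite lerNl -normrN ler_norm.
have e0 := normr_ge0 e.
have pe : 0 < p + e by lra.
split=> //.
have -> : D * ((p - 1) / (p + e)) - D = - (D * (1 + e)) / (p + e).
  by field; rewrite gt_eqF.
rewrite normrM normrN normfV (gtr0_norm pe) ltr_pdivrMr // normrM (gtr0_norm D0).
apply: (@le_lt_trans _ _ (D * (1 + `|e|))).
  by rewrite ler_wpM2l ?(ltW D0) // (le_trans (ler_normD _ _)) // normr1.
rewrite [ltRHS]mulrC -ltr_pdivrMr //; lra.
Qed.

Lemma coprime_large_primes x Q : (0 < x)%N -> (0 < Q)%N ->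
  (forall q, prime q -> (q %| Q)%N -> (x < q)%N) -> coprime x Q.
Proof.
move=> x0 Q0 H; rewrite coprime_has_primes //; apply/hasPn => q.
rewrite mem_primes => /and3P[pq _ qQ]; rewrite /= mem_primes pq x0 /=.
by apply/negP => /(dvdn_leq x0); rewrite leqNgt H.
Qed.

Section Approximation.
Variables (R : realType) (a m : nat) (b r : int) (c d : R) (t : nat).
Hypotheses (a0 : (0 < a)%N) (m0 : (0 < m)%N) (c0 : 0 < c) (t0 : (0 < t)%N).
Let g := gcd_ab a m b r.
Let D := bigD a m b r c.

(** First Q is chosen so that D times the product rho of the 1 - 1/q is just below
    x, then p so large that the remaining factor is negligible. *)
Lemma approximation (x eps : R) : 0 < x < D -> 0 < eps ->
  exists n, [/\ setM a m b r c d n, (n%:Z = r %[mod m%:Z])%Z,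
    selected a m b r t true true true n & `|phi_ratio a b c d n - x| < eps].
Proof.
move=> /andP[x0 xD] eps0.
have D0 : 0 < D by exact: bigD_gt0.
have g0 : (0 < g)%N by exact: gcd_ab_gt0.
have am0 : (0 < a * m)%N by rewrite muln_gt0 a0.
have xD1 : 0 < x / D < 1 by rewrite divr_gt0 //= ltr_pdivrMr // mul1r.
have epsD : 0 < eps / (2 * D) by rewrite divr_gt0 // mulr_gt0.
have [B [N [BB]]] := prime_product_dense (maxn g t).+1 am0 xD1 epsD.
have pc p : prime_in_class (a * m) 1 p -> prime p by case/andP.
have := prime_product_spec R B N pc.
set Q := (\prod_(B <= p < N | _) p)%N; set rho := \prod_(B <= p < N | _) _.
case=> Q0 Qp Ql Qt /andP[rho1 rho2].
have Q1 : Q = 1 %[mod a * m] by exact: prod_eq1_mod.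
pose y := D * rho.
have y1 : x - eps / 2 < y.
  rewrite /y [ltRHS]mulrC -ltr_pdivrMr //; apply: le_lt_trans rho1.
  by rewrite le_eqVlt; apply/orP; left; apply/eqP; field; rewrite gt_eqF.
have y2 : y <= x by rewrite /y mulrC -ler_pdivlMr //.
pose eta := Num.min (eps / 2) (D - x).
have eta0 : 0 < eta by rewrite lt_min subr_gt0 xD andbT divr_gt0.
(* c n + d = (c / a) (a n + b + e) *)
pose e : R := a%:R * d / c - b%:~R.
pose h : R := (g * Q)%:R.
have h1 : 1 <= h by rewrite /h ler1n muln_gt0 g0.
have h0 : 0 < h by lra.
have eh : `|e / h| <= `|e|.
  rewrite normrM ler_piMr // normfV ger0_norm ?invf_le1 //; lra.
pose K := `|e| + 1 + D * (1 + `|e|) / eta.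
have K0 : 0 <= K.
  by rewrite !addr_ge0 // !mulr_ge0 ?invr_ge0 ?addr_ge0 // ltW.
have := archi_boundP K0; set B1 := Num.bound K => KB.
have [p [n [pp Bp n0 nr nE]]] :=
  exists_arithmetic_solution R b r (B1 + g * Q + t) a0 m0 Q0 Q1.
rewrite -/g in nE.
have affE : affine a b n = (g * Q * p)%N by rewrite /affine nE.
have p0 := prime_gt0 pp.
have NP : (n%:R : R) * a%:R = h * p%:R - b%:~R.
  have := congr1 (fun z : int => z%:~R : R) nE.
  rewrite intrD intrM -!pmulrn natrM -/h => <-; ring.
have a0' : 0 < a%:R :> R by rewrite ltr0n.
have rho0 : 0 < rho.
  have : 0 < Q%:R * rho by rewrite -Qt ltr0n totient_gt0.
  by rewrite pmulr_rgt0 // ltr0n.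
have y0 : 0 < y by rewrite mulr_gt0.
have yD : y < D by exact: le_lt_trans xD.
have [B1p gQp tp] : [/\ (B1 < p)%N, (g * Q < p)%N & (t < p)%N].
  by split; move: Bp; clear; lia.
have [pe close] : 0 < p%:R + e / h /\ `|y * ((p%:R - 1) / (p%:R + e / h)) - y| < eta.
  have Kp : K < p%:R by apply: lt_trans KB _; rewrite ltr_nat.
  apply: ratio_factor_close => //; apply: le_lt_trans Kp.
  rewrite /K; apply: lerD; first by rewrite lerD2r.
  rewrite ler_wpM2r ?invr_ge0 ?(ltW eta0) // ler_pM ?addr_ge0 ?(ltW y0) ?(ltW yD) //.
  by rewrite lerD2l.
have denE : c * n%:R + d = c / a%:R * h * (p%:R + e / h).
  have -> : n%:R = (h * p%:R - b%:~R) / a%:R :> R by rewrite -NP mulfK // gt_eqF.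
  by rewrite /e; field; rewrite !pnatr_eq0 -!lt0n Q0 g0 a0 andbT gt_eqF.
have pQ : ~~ (p %| Q)%N.
  apply/negP => /(dvdn_leq Q0); rewrite leqNgt => /negP; apply.
  by apply: leq_ltn_trans gQp; rewrite leq_pmull.
have pg : ~~ (p %| g)%N.
  apply/negP => /(dvdn_leq g0); rewrite leqNgt => /negP; apply.
  by apply: leq_ltn_trans gQp; rewrite leq_pmulr.
have Qlarge q : prime q -> (q %| Q)%N -> (maxn g t < q)%N.
  by move=> pq qQ; have [_ /andP[Bq _]] := Qp q pq qQ; exact: leq_trans Bq.
have Qg : coprime g Q.
  by apply: coprime_large_primes => // q pq /(Qlarge q pq); rewrite gtn_max => /andP[].
have phiE : phi_ratio a b c d n = y * ((p%:R - 1) / (p%:R + e / h)).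
  rewrite /phi_ratio affE denE totient_coprime; last first.
    by rewrite coprime_sym prime_coprime // Euclid_dvdM // negb_or pg.
  rewrite totient_coprime // (totient_prime pp) -subn1 !natrM natrB // Qt -/rho.
  rewrite /y /D /bigD -/g.
  have hE : h = g%:R * Q%:R by rewrite /h natrM.
  move: pe; rewrite hE => pe.
  have h0' : 0 < g%:R * Q%:R :> R by rewrite -hE.
  rewrite (_ : p%:R + e / (g%:R * Q%:R) = (p%:R * (g%:R * Q%:R) + e) / (g%:R * Q%:R)); last first.
    by field; rewrite !pnatr_eq0 -!lt0n g0 Q0.
  have pe' : 0 < p%:R * (g%:R * Q%:R) + e.
    by have := mulr_gt0 pe h0'; rewrite mulrDl divfK // gt_eqF.
  field; rewrite !pnatr_eq0 -!lt0n a0 g0 Q0 !gt_eqF //.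
have cofE : cofact a m b r n = (Q * p)%N.
  by rewrite /cofact affE -/g -mulnA mulKn.
have Qp0 : (0 < Q * p)%N by rewrite muln_gt0 Q0.
have lpQ q : logn q (Q * p) = (logn q Q + (q == p))%N.
  by rewrite lognM // (logn_prime q pp).
exists n; split => //.
- split=> //.
  + rewrite gt_max -!mulNr !ltr_pdivrMr // NP mulrC -[n%:R * c]mulrC.
    have cn : 0 < c * n%:R + d by rewrite denE !mulr_gt0 ?invr_gt0 //; lra.
    have hp : 0 < h * p%:R by rewrite mulr_gt0 // ltr0n.
    by apply/andP; split; lra.
  + rewrite phiE -/D; move: close; rewrite ltr_norml => /andP[_].
    by rewrite /eta lt_min => /andP[_]; move: y2; lra.
- split=> _.
  + rewrite /cond1 cofE; apply: squarefree_logn => // q; rewrite lpQ.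
    have [->|_] := eqVneq q p; first by rewrite logn_notdvd.
    by rewrite addn0.
  + rewrite /cond2 cofE coprime_sym; apply: coprime_large_primes => // q pq.
    rewrite Euclid_dvdM // => /orP[/(Qlarge q pq)|]; first by rewrite gtn_max => /andP[].
    by rewrite dvdn_prime2 // => /eqP ->.
  + rewrite /cond3 cofE; have exc q : prime q -> (q %| Q * p)%N -> q <> 1 %[mod a] -> q = p.
      move=> pq; rewrite Euclid_dvdM // => /orP[/(Qp q pq)[/andP[_ /eqP q1] _] []|].
        by rewrite -(modn_dvdm q (dvdn_mulr m (dvdnn a))) q1 modn_dvdm // dvdn_mulr.
      by rewrite dvdn_prime2 // => /eqP.
    split=> [q q' [pq qd qa] [pq' qd' qa']|q [pq qd qa]].
      by rewrite (exc q) // (exc q').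
    have qp := exc q pq qd qa; split; first by rewrite lpQ qp eqxx logn_notdvd.
    by case: (a) a0 qa => [|[|]] // _; rewrite !modn1.
- have e2 : eta <= eps / 2 by rewrite ge_min lexx.
  rewrite phiE; move: close; rewrite !ltr_norml => /andP[l1 l2].
  by apply/andP; split; lra.
Qed.

End Approximation.

Theorem corollary10 (R : realType) (a m : nat) (b r : int) (c d : R)
    (ha : (0 < a)%N) (hm : (0 < m)%N) (hc : 0 < c) :
  dense_in `]0, bigD a m b r c] (setL a m b r c d setT) /\
  (forall t : nat, (0 < t)%N -> forall s1 s2 s3 : bool,
     dense_in `]0, bigD a m b r c]
       (setL a m b r c d (selected a m b r t s1 s2 s3))).
Proof.
have D0 : 0 < bigD a m b r c by exact: bigD_gt0.
have key t (E : set nat) : (0 < t)%N -> selected a m b r t true true true `<=` E ->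
    dense_in `]0, bigD a m b r c] (setL a m b r c d E).
  move=> t0 SE; split.
    move=> _ [n [Mn _ _] <-]; rewrite /= in_itv /= (phi_ratio_gt0 ha hc Mn) /=.
    by case: Mn.
  move=> x; rewrite /= in_itv /= => /andP[x0 xD] U /nbhs_ballP[eps /= eps0 ballU].
  pose x' := Num.max (x / 2) (x - eps / 2).
  have x'D : 0 < x' < bigD a m b r c.
    rewrite lt_max divr_gt0 //= gt_max.
    by apply/andP; split; lra.
  have x'x : x - eps / 2 <= x' <= x.
    rewrite le_max lexx orbT /= ge_max; apply/andP; split; lra.
  have e2 : 0 < eps / 2 by rewrite divr_gt0.
  have [n [Mn nr sel close]] := approximation d ha hm hc t0 x'D e2.
  exists (phi_ratio a b c d n); split.
    by exists n => //; split=> //; exact: SE.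
  apply: ballU; rewrite /ball /=.
  move: x'x close; rewrite !ltr_norml => /andP[? ?] /andP[? ?].
  by apply/andP; split; lra.
split; first exact: (key 1%N).
by move=> t t0 s1 s2 s3; apply: (key t) => // n [S1 S2 S3]; split=> _; auto.
Qed.
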